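(* Let $P$ be a $k$-neighborly $d$-polytope with $2k < d \le 3k - 1$. Then $f_{d-1}(P) \ge f_{0}(P)$, and the equality is attained only if $P$ is a simplex.
   Context: A $d$-polytope is a $d$-dimensional convex polytope; $f_i(P)$ is the number of $i$-dimensional faces of $P$. For an integer $k$, $P$ is $k$-neighborly if every set of $k$ vertices of $P$ is the vertex set of some face of $P$. *)

(* Defs.v *)
From mathcomp Require Import all_boot all_order all_algebra finmap.
From mathcomp Require Import boolp classical_sets functions cardinality reals.
From mathcomp Require Import convex.

Set Implicit Arguments.
Unset Strict Implicit.
Unset Printing Implicit Defensive.

Import Order.TTheory GRing.Theory Num.Theory.
Local Open Scope classical_set_scope.
Local Open Scope card_scope.
Local Open Scope ring_scope.

(* A d-polytope is allowed to live in an ambient space R^n of any dimension n,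
   not only n = d. *)

Section Polytopes.
Context {R : realType} {n : nat}.
Local Notation V := 'rV[R]_n.
Implicit Types (A P F S : set V) (i d k : nat).

Definition convex_hull A : set V := smallest (@convex_set R V) A.

Definition affine_set A : Prop :=
  forall (x y : V) (t : R), A x -> A y -> A (t *: x + (1 - t) *: y).

Definition affine_hull A : set V := smallest affine_set A.

(* The affine hull of A is a translate of an i-dimensional linear subspace;
   no natural number i is a dimension of the empty set. *)
Definition has_dim A i : Prop :=
  exists (x : V) (U : {vspace V}),
    affine_hull A = [set x + u | u in [set` U]] /\ \dim U = i.

Definition polytope P : Prop :=
  exists2 A : set V, finite_set A & P = convex_hull A.

Definition dpolytope d P : Prop := polytope P /\ has_dim P d.

Definition dotp (c x : V) : R := \sum_(j < n) c 0 j * x 0 j.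

(* Taking c = 0, both P itself (b = 0) and the empty set (b = 1) are faces. *)
Definition face P F : Prop :=
  exists (c : V) (b : R),
    (forall x, P x -> dotp c x <= b) /\ F = P `&` [set x | dotp c x = b].

Definition faces_of_dim i P : set (set V) :=
  [set F | face P F /\ has_dim F i].

(* fset_set yields the empty set on infinite sets; this case does not arise
   when P is a polytope, which has only finitely many faces. *)
Definition fnum i P : nat :=
  #|` fset_set (faces_of_dim i P) |%fset.

Definition vertices P : set V := [set x | face P [set x]].

Definition neighborly k P : Prop :=
  forall S, S `<=` vertices P -> S #= `I_k ->
  exists2 F, face P F & vertices F = S.

Definition affinely_independent m (p : 'I_m -> V) : Prop :=
  forall a : 'I_m -> R,
    \sum_(j < m) a j = 0 -> \sum_(j < m) a j *: p j = 0 -> forall j, a j = 0.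

Definition simplex P : Prop :=
  exists (m : nat) (p : 'I_m.+1 -> V),
    affinely_independent p /\ P = convex_hull (range p).

End Polytopes.

(* Main.v *)
(* Encode a face of P by the set of vertices on it, and let f_i, m_i be the
   numbers of facets and of vertices in a chain of faces
   P = F_d > F_(d-1) > ... > F_(2k-1), each a largest facet of the previous one.
   - Every k-set of vertices of F_i is a face of F_i of rank at most k, hence lies
     in at least i + 1 - k facets of F_i; double counting gives
     f_i * C(m_(i-1), k) >= (i + 1 - k) * C(m_i, k).
   - Distinct facets of F_(i-1) lie in distinct further facets of F_i,
     so f_(i-1) < f_i.
   - By Radon's theorem F_(2k-1) has at most 2k vertices.
   Multiplying, with N = m_d, f = f_d and r = d + 1 - 2k <= k, the falling
   factorials satisfy f^_r * C(2k, k) * k! >= (k + r)! * C(N, k), and N > d turns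
   this into f^_r >= N^_r, i.e. f >= N.  If f = N then every step is tight; in
   F_(2k) every k-set lies in exactly k + 1 facets, which forces F_(2k) to be a
   simplex, whence f = d + 1 = N. *)
Require Import Defs.
From mathcomp Require Import all_boot all_order all_algebra finmap.
From mathcomp Require Import boolp interval_inference.
From mathcomp Require Import ring lra zify.

Set Implicit Arguments.
Unset Strict Implicit.
Unset Printing Implicit Defensive.

Import Order.TTheory GRing.Theory Num.Theory.
Local Open Scope ring_scope.

(** * Faces of a configuration, from the values of its affine functionals *)

Section Covectors.
Variables (R : realFieldType) (N : nat) (L : {vspace 'rV[R]_N}).
Implicit Types (A B I J H S : {set 'I_N}) (c e f g a : 'rV[R]_N) (i j : 'I_N).

(* [L] stands for the space of value vectors, on [N] points, of the affine
   functionals; faces are sets of points, and the rank of [A] (its affine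
   dimension plus one) is [\dim L - \dim (ann A)]. *)
Definition coord_lfun i : 'Hom('rV[R]_N, 'M[R]_1) := linfun (col i).

Definition ann A : {vspace 'rV[R]_N} :=
  (L :&: \bigcap_(i in A) lker (coord_lfun i))%VS.

Lemma annP A f :
  reflect (f \in L /\ forall i, i \in A -> f 0 i = 0) (f \in ann A).
Proof.
rewrite memv_cap; apply: (iffP andP) => -[fL fA]; split=> //.
  move=> i iA; have /subvP/(_ f fA) := bigcapv_inf (Us := fun i => lker (coord_lfun i)) _ (iA : (fun i => i \in A) i) (subvv _).
  by rewrite memv_ker lfunE => /eqP/matrixP/(_ 0 0); rewrite !mxE.
rewrite memvE; apply/subv_bigcapP => i iA; rewrite -memvE memv_ker lfunE.
by apply/eqP/matrixP => x y; rewrite ord1 !mxE fA.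
Qed.

Lemma annS A B : A \subset B -> (ann B <= ann A)%VS.
Proof.
move=> /subsetP AB; apply/subvP => f /annP[fL fB].
by apply/annP; split=> // i /AB/fB.
Qed.

Definition zeros A c := [set i in A | c 0 i == 0].

Definition nonneg_on A c := forall i, i \in A -> 0 <= c 0 i.

(** [c] is the slack vector of an inequality valid on [A]; [I] collects the points where it is
    tight. *)
Definition iface A I : Prop :=
  exists2 c, c \in L & nonneg_on A c /\ zeros A c = I.

(** The annihilator gains one dimension exactly when the rank drops by one. *)
Definition facets A : {set {set 'I_N}} :=
  [set J | `[< iface A J >] & \dim (ann J) == (\dim (ann A)).+1].

Lemma zeros_sub A c : zeros A c \subset A.
Proof. by apply/subsetP => i; rewrite inE => /andP[]. Qed.

Lemma iface_sub A I : iface A I -> I \subset A.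
Proof. by move=> [c _ [_ <-]]; exact: zeros_sub. Qed.

Lemma ann_zeros A c : c \in L -> c \in ann (zeros A c).
Proof. by move=> cL; apply/annP; split=> // i; rewrite inE => /andP[_ /eqP]. Qed.

(** The functional [g] exposing [J] is not zero on all of [A], so it accounts for the single
    dimension separating [ann J] from [ann A]. *)
Lemma facetsP A J : J \in facets A ->
  exists2 g, g \in L &
    [/\ nonneg_on A g, zeros A g = J & ann J = (ann A + <[g]>)%VS].
Proof.
rewrite inE => /andP[/asboolP[g gL [g0 gJ]] /eqP dJ]; exists g => //; split=> //.
apply/esym/eqP; rewrite eqEdim subv_add annS -?gJ ?zeros_sub //= -memvE ann_zeros //=.
rewrite gJ dJ; have gA : g \notin ann A.
  apply/negP => /annP[_ gA]; have : J = A.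
    by rewrite -gJ; apply/setP => i; rewrite inE; case: (boolP (i \in A)) => //= /gA ->; rewrite eqxx.
  by move=> E; move: dJ; rewrite E => /n_Sn.
rewrite dimv_disjoint_sum; last first.
  apply/eqP; rewrite -subv0; apply/subvP => v /memv_capP[vA /vlineP[t vE]].
  move: vA; rewrite vE memv0; have [->|t0] := eqVneq t 0; first by rewrite scale0r.
  by move=> /(memvZ t^-1); rewrite scalerA mulVf // scale1r (negPf gA).
by rewrite dim_vline addnC; case: eqP gA => // ->; rewrite mem0v.
Qed.

Lemma facet_iface A J : J \in facets A -> iface A J.
Proof. by rewrite inE => /andP[/asboolP]. Qed.

Lemma facet_dim A J : J \in facets A -> \dim (ann J) = (\dim (ann A)).+1.
Proof. by rewrite inE => /andP[_ /eqP]. Qed.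

Lemma facet_sub A J : J \in facets A -> J \subset A.
Proof. by move/facet_iface/iface_sub. Qed.

(* Moving from [c] in the direction [e] until a new coordinate vanishes. *)
Lemma pivot A c e i :
    nonneg_on A c -> zeros A c \subset zeros A e -> i \in A -> e 0 i < 0 ->
  exists2 t, 0 < t & nonneg_on A (c + t *: e) /\
    zeros A c \proper zeros A (c + t *: e).
Proof.
move=> c0 ce iA ei.
pose P j := (j \in A) && (e 0 j < 0); have Pi : P i by rewrite /P iA.
pose q j := c 0 j / - e 0 j.
case: (arg_minP q Pi) => j /andP[jA ej] jmin.
have cgt0 l : P l -> 0 < c 0 l.
  move=> /andP[lA el]; rewrite lt_neqAle c0 // andbT eq_sym; apply/negP => cl.
  have : l \in zeros A e by apply: (subsetP ce); rewrite inE lA.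
  by rewrite inE lA /= => /eqP el0; move: el; rewrite el0 ltxx.
have qj : c 0 j + q j * e 0 j = 0.
  by rewrite /q invrN mulrN mulNr divfK ?subrr // lt_eqF.
exists (q j); first by rewrite divr_gt0 ?cgt0 ?oppr_gt0 // /P jA.
split.
  move=> l lA; rewrite !mxE; have [el|el] := leP 0 (e 0 l).
    by rewrite addr_ge0 ?c0 // mulr_ge0 // divr_ge0 ?c0 // oppr_ge0 ltW.
  have /jmin : P l by rewrite /P lA.
  rewrite {2}/q ler_pdivlMr ?oppr_gt0 // mulrN.
  by rewrite -subr_ge0 opprK addrC.
rewrite properE; apply/andP; split.
  apply/subsetP => l lc; have /(subsetP ce) := lc.
  move: lc; rewrite !inE => /andP[-> /eqP cl] /andP[_ /eqP el].
  by rewrite !mxE cl el mulr0 addr0 eqxx.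
apply/subsetPn; exists j; first by rewrite inE jA !mxE qj eqxx.
by rewrite inE jA /= gt_eqF // cgt0 // /P jA.
Qed.

(** Induction on the number of points of [A] where [c] is nonzero. If [ann (zeros A c)] is spanned
    by [c] modulo [ann A], the zeros form a facet. Otherwise one pivot gives [c'] with more zeros, a
    second one along [- c'] gives [c - s c'] with more zeros, and [c] is a combination of the
    two. *)
Lemma nonneg_span_facets A I c : c \in L -> nonneg_on A c -> I \subset zeros A c ->
  c \in (ann A + \sum_(J in facets A | I \subset J) ann J)%VS.
Proof.
set X := (ann A + _)%VS.
have XA : (ann A <= X)%VS by exact: addvSl.
have [m] := ubnP #|A :\: zeros A c|; elim: m c => // m IHm c Am cL c0 Ic.
have next c' : c' \in L -> nonneg_on A c' -> zeros A c \proper zeros A c' -> c' \in X.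
  move=> c'L c'0 cc'; apply: IHm => //; last by apply: subset_trans Ic (proper_sub cc').
  apply: leq_trans (ltnSE Am) => //; apply: proper_card.
  case/properP: cc' => s [j jc' jc]; apply/properP; split; first exact: setDS.
  by exists j; rewrite !in_setD ?jc ?jc' ?(subsetP (zeros_sub A c') _ jc').
have [cA|cA] := boolP (c \in ann A); first exact: (subvP XA _ cA).
have Zann := ann_zeros A cL.
have [eZ|/subvPn[e eZ eA]] := boolP (ann (zeros A c) <= ann A + <[c]>)%VS.
  apply: (subvP (addvSr _ _)).
  have ZF : zeros A c \in facets A.
    rewrite inE; apply/andP; split; first by apply/asboolP; exists c.
    rewrite eqn_leq; apply/andP; split.
      apply: leq_trans (dimvS eZ) _; apply: leq_trans (dimv_add_leqif _ _) _.
      by rewrite dim_vline -[X in (_ <= X)%N]addn1 leq_add2l leq_b1.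
    rewrite (ltn_leqif (dimv_leqif_sup (annS (zeros_sub A c)))).
    by apply: contra cA => /subvP; apply.
  by rewrite memvE; apply: (sumv_sup (zeros A c)); rewrite ?ZF // -memvE.
have [eL e0] := annP _ _ eZ.
wlog [i iA ei] : e eZ eA eL e0 / exists2 i, i \in A & e 0 i < 0.
  move=> W; have [/existsP[i /andP[iA ei]]|] := boolP [exists i in A, e 0 i != 0].
    case: (ltgtP (e 0 i) 0) ei => // ei _; first by apply: (W e) => //; exists i.
    apply: (W (- e)); rewrite ?memvN //; last by exists i; rewrite // mxE oppr_lt0.
    by move=> j /e0 ej; rewrite mxE ej oppr0.
  move=> /existsPn e00; case/negP: eA; apply: (subvP (addvSl _ _)).
  by apply/annP; split=> // j jA; move: (e00 j); rewrite jA negbK => /eqP.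
have ce : zeros A c \subset zeros A e.
  by apply/subsetP => j jc; rewrite inE (subsetP (zeros_sub A c)) //= e0.
have [t t0 [c'0 cc']] := pivot c0 ce iA ei.
set c' := c + t *: e in c'0 cc'.
have c'L : c' \in L by rewrite memvD // memvZ.
have c'X := next _ c'L c'0 cc'.
have [j jA c'j] : exists2 j, j \in A & 0 < c' 0 j.
  have [/existsP[j /andP[jA ej]]|/existsPn c'00] := boolP [exists j in A, c' 0 j != 0].
    by exists j; rewrite // lt_neqAle eq_sym ej c'0.
  case/negP: eA; have -> : e = t^-1 *: c' - t^-1 *: c.
    by rewrite -scalerBr /c' addrC addKr scalerA mulVf ?scale1r // gt_eqF.
  rewrite memvB //; last by rewrite memvZ // (subvP (addvSr _ _)) // memv_line.
  rewrite memvZ // (subvP (addvSl _ _)) //; apply/annP; split=> // l lA.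
  by move: (c'00 l); rewrite lA negbK => /eqP.
have [||s s0 [c''0 cc'']] := @pivot A c (- c') j c0 _ jA.
- apply/subsetP => l /(subsetP (proper_sub cc')); rewrite !inE.
  by case/andP=> -> /eqP E; rewrite mxE E oppr0 eqxx.
- by rewrite mxE oppr_lt0.
have := next _ _ c''0 cc''; rewrite memvD ?memvZ ?memvN // => /(_ isT) c''X.
have -> : c = (c + s *: - c') + s *: c' by rewrite scalerN subrK.
by rewrite memvD // memvZ.
Qed.

(** Modulo [ann A], each facet over [I] contributes one generator. These span [ann I], because every
    [e] in it is a difference of the nonnegative functionals [e + t c] and [t c]. *)
Lemma leq_dim_ann_facets A I : iface A I ->
  (\dim (ann I) <= \dim (ann A) + #|[set J in facets A | I \subset J]|)%N.
Proof.
move=> [c cL [c0 cI]].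
set X := (ann A + \sum_(J in facets A | I \subset J) ann J)%VS.
have cX : c \in X by apply: nonneg_span_facets; rewrite // cI.
have annX : (ann I <= X)%VS.
  apply/subvP => e /annP[eL e0].
  (* The term at [j] alone gives [|e_j| <= t c_j] wherever [c_j > 0]; points with [c_j = 0]
     contribute 0, as the inverse of 0 is 0. *)
  pose t := \sum_(j in A) `|e 0 j| / c 0 j.
  have t0 : 0 <= t by apply: sumr_ge0 => j jA; rewrite divr_ge0 // c0.
  have -> : e = (e + t *: c) - t *: c by rewrite addrK.
  rewrite memvB ?memvZ //; apply: nonneg_span_facets; first by rewrite memvD ?memvZ.
    move=> j jA; rewrite !mxE; have [jI|jI] := boolP (j \in I).
      by rewrite e0 // add0r mulr_ge0 // c0.
    have cj : 0 < c 0 j.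
      by rewrite lt_neqAle c0 // andbT eq_sym; apply: contra jI => cj; rewrite -cI inE jA.
    suff : `|e 0 j| <= t * c 0 j by have := ler_norm (- e 0 j); rewrite normrN; lra.
    rewrite -ler_pdivrMr // /t (bigD1 j) //= lerDl sumr_ge0 // => l /andP[lA _].
    by rewrite divr_ge0 // c0.
  apply/subsetP => j jI; have := jI; rewrite -{1}cI !inE !mxE => /andP[-> /eqP ->].
  by rewrite e0 // mulr0 addr0 eqxx.
(* A total choice of the generator of [ann J] modulo [ann A], with default value 0 when there is
   none. *)
pose g J := if pselect (exists g, ann J = (ann A + <[g]>)%VS) is left h
  then projT1 (cid h) else 0.
have gP J : J \in facets A -> ann J = (ann A + <[g J]>)%VS.
  move=> /facetsP[h _ [_ _ hJ]]; rewrite /g; case: pselect => [ex|[]]; last by exists h.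
  by case: (cid ex).
have : (ann I <= ann A + <<[seq g J | J in [set J in facets A | I \subset J]]>>)%VS.
  apply: subv_trans annX _; rewrite subv_add addvSl; apply/subv_sumP => J JF.
  rewrite gP ?(andP JF).1 // addvS // -memvE memv_span // map_f // mem_enum inE.
  by [].
move=> /dimvS/leq_trans; apply; apply: leq_trans (dimv_add_leqif _ _) _.
by rewrite leq_add2l; apply: leq_trans (dim_span _) _; rewrite size_map -cardE.
Qed.

(** Outside [J], where [c] may be negative, [g] is positive; adding a large multiple of [g] makes
    the sum positive there and changes nothing on [J]. *)
Lemma iface_trans A J I : iface A J -> iface J I -> iface A I.
Proof.
move=> AJ; have /subsetP JA := iface_sub AJ; case: AJ => g gL [g0 gJ] [c cL [c0 cI]].
pose t := 1 + \sum_(j in A) `|c 0 j| / g 0 j.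
have tgt0 : 0 < t.
  by rewrite ltr_pwDl // sumr_ge0 // => j jA; rewrite divr_ge0 // g0.
have gt0 j : j \in A -> j \notin J -> 0 < c 0 j + t * g 0 j.
  move=> jA jJ; have gj : 0 < g 0 j.
    by rewrite lt_neqAle g0 // andbT eq_sym; apply: contra jJ => gj; rewrite -gJ inE jA.
  suff : `|c 0 j| < t * g 0 j by have := ler_norm (- c 0 j); rewrite normrN; lra.
  rewrite -ltr_pdivrMr // /t (bigD1 j) //=.
  have : 0 <= \sum_(i in A | i != j) `|c 0 i| / g 0 i.
    by apply: sumr_ge0 => l /andP[lA _]; rewrite divr_ge0 // g0.
  by lra.
have gJ0 j : j \in J -> g 0 j = 0 by rewrite -gJ inE => /andP[_ /eqP].
exists (c + t *: g); first by rewrite memvD ?memvZ.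
split=> [j jA|]; rewrite ?mxE.
  have [jJ|jJ] := boolP (j \in J); last by rewrite ltW ?gt0.
  by rewrite gJ0 // mulr0 addr0 c0.
apply/setP => j; rewrite -cI !inE !mxE; have [jJ|jJ] /= := boolP (j \in J).
  by rewrite gJ0 // mulr0 addr0 JA.
by case: (boolP (j \in A)) => //= jA; rewrite gt_eqF ?gt0.
Qed.

(** The functional exposing [J] lies in [ann J], so a facet with the same annihilator is contained
    in its zeros. *)
Lemma facet_inj A : {in facets A &, injective ann}.
Proof.
have sub J H : J \in facets A -> H \in facets A -> ann J = ann H -> H \subset J.
  move=> /facetsP[g gL [_ gJ _]] /facet_sub/subsetP HA E.
  have : g \in ann H by rewrite -E -gJ ann_zeros.
  by move=> /annP[_ gH]; apply/subsetP => i iH; rewrite -gJ inE HA // gH //=.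
by move=> J H JF HF E; apply/eqP; rewrite eqEsubset (sub _ _ HF JF) ?(sub _ _ JF HF).
Qed.

(** The rank of [I] is two below that of [A], so at least two facets contain [I]. If [H] is another
    one, [ann H + ann J = ann I] by dimension; the functional cutting [I] out of [J] then vanishes
    on [H :&: J]. *)
Lemma adjacent_facet A J I : J \in facets A -> I \in facets J ->
  exists2 H, H \in facets A & H != J /\ H :&: J = I.
Proof.
move=> JF IF; have IJ := facet_sub IF.
have AI := iface_trans (facet_iface JF) (facet_iface IF).
have dI : \dim (ann I) = (\dim (ann A)).+2 by rewrite (facet_dim IF) (facet_dim JF).
pose F := [set H in facets A | I \subset H].
have F2 : (2 <= #|F|)%N by have := leq_dim_ann_facets AI; rewrite dI -/F; lia.
have JFI : J \in F by rewrite inE JF.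
have [H] : exists H, H \in F :\ J.
  by apply/set0Pn; rewrite -card_gt0; move: F2; rewrite (cardsD1 J F) JFI.
rewrite in_setD1 in_set => /and3P[HJ HF IH]; exists H => //; split=> //.
apply/eqP; rewrite eqEsubset subsetI IH IJ !andbT.
have annE : (ann H + ann J)%VS = ann I.
  apply/eqP; rewrite eqEdim subv_add !annS //= dI -(facet_dim JF).
  rewrite (ltn_leqif (dimv_leqif_sup (addvSr _ _))) subv_add subvv andbT.
  apply: contra HJ => s; apply/eqP/(facet_inj HF JF)/eqP.
  by rewrite eqEdim s (facet_dim JF) (facet_dim HF) leqnn.
have : (ann I <= ann (H :&: J))%VS.
  by rewrite -annE subv_add !annS ?subsetIl ?subsetIr.
have [c cL [_ cI _]] := facetsP IF.
have := ann_zeros J cL; rewrite cI => cI' /subvP/(_ _ cI')/annP[_ c0].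
by apply/subsetP => i iHJ; rewrite -cI inE c0 // eqxx andbT; case/setIP: iHJ.
Qed.

(** Each facet of [J] is cut out by a facet of [A] other than [J], so intersecting with [J] maps a
    subset of [facets A :\ J] onto [facets J]. *)
Lemma ltn_card_facets A J : J \in facets A -> (#|facets J| < #|facets A|)%N.
Proof.
move=> JF; rewrite [X in (_ < X)%N](cardsD1 J) JF ltnS.
have -> : facets J = [set H :&: J | H in [set H in facets A :\ J | H :&: J \in facets J]].
  apply/setP => I; apply/idP/imsetP => [IF|[H]]; last by rewrite in_set => /andP[_ ?] ->.
  by have [H HF [HJ E]] := adjacent_facet JF IF; exists H; rewrite ?E // in_set in_setD1 HF HJ E.
by apply: leq_trans (leq_imset_card _ _) _; apply/subset_leq_card/subsetP => H; rewrite in_set => /andP[].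
Qed.
End Covectors.

(** * Neighborly configurations *)

Lemma card_between (T : finType) (A B : {set T}) k :
  A \subset B -> (#|A| <= k <= #|B|)%N ->
  exists2 S : {set T}, A \subset S & S \subset B /\ #|S| = k.
Proof.
elim: k => [|k IHk] AB /andP[Ak kB]; first by exists A; rewrite ?subxx //; split=> //; lia.
have [E|Ak'] := eqVneq #|A| k.+1; first by exists A; rewrite ?subxx.
have [|S AS [SB Sk]] := IHk AB; first by lia.
have : S \proper B by rewrite properEcard SB Sk.
case/properP => _ [x xB xS]; exists (x |: S); first exact: subset_trans AS (subsetUr _ _).
by rewrite subUset sub1set xB SB cardsU1 xS Sk.
Qed.

Lemma leq_ffact m n j : (m <= n)%N -> (m ^_ j <= n ^_ j)%N.
Proof. by elim: j m n => // j IHj m n mn; rewrite !ffactnS leq_mul // IHj; lia. Qed.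

Lemma ltn_ffact m n j : (m < n)%N -> (0 < j <= n)%N -> (m ^_ j < n ^_ j)%N.
Proof.
case: n j => // n [//|j]; rewrite !ltnS => mn jn.
apply: leq_ltn_trans (leq_ffact _ mn) _.
rewrite ffactnSr ffactSS mulnC ltn_pmul2r ?ffact_gt0 //; lia.
Qed.

Lemma ffactnD n i j : (n ^_ (i + j) = n ^_ i * (n - i) ^_ j)%N.
Proof.
elim: i n => [|i IHi] n; first by rewrite ffactn0 mul1n subn0.
by rewrite addSn !ffactnS IHi mulnA; congr (_ * _ ^_ _)%N; lia.
Qed.

(** Put [j = d + 1 - 2k]; the bound on [d] says [j <= k]. Cancelling [n ^_ j] and [(k + j)!] leaves
    [(2k) ^_ (k - j) <= (n - j) ^_ (k - j)], and [d < n] says [2k <= n - j]. *)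
Lemma ffact_compare k d n : (2 * k < d)%N -> (d <= 3 * k - 1)%N -> (d < n)%N ->
  (n ^_ (d.+1 - 2 * k) * ('C(2 * k, k) * k`!) <= (d.+1 - k)`! * 'C(n, k))%N.
Proof.
move=> kd dk dn; rewrite -(leq_pmul2r (fact_gt0 k)) -!mulnA.
have -> : ('C(2 * k, k) * (k`! * k`!) = (2 * k)`!)%N.
  have E : (2 * k - k = k)%N by lia.
  by rewrite -(@bin_fact (2 * k) k) ?E //; lia.
rewrite bin_ffact.
set j := (d.+1 - 2 * k)%N; have jk : (j <= k)%N by rewrite /j; lia.
have -> : (d.+1 - k = k + j)%N by rewrite /j; lia.
have -> : (n ^_ k = n ^_ j * (n - j) ^_ (k - j))%N.
  by rewrite -ffactnD subnKC.
rewrite mulnCA leq_mul2l; apply/orP; right.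
rewrite -(@ffact_fact (2 * k) (k - j)); last by lia.
have -> : (2 * k - (k - j) = k + j)%N by lia.
by rewrite mulnC leq_mul2l leq_ffact ?orbT // /j; lia.
Qed.

Section Perp.
Variables (R : fieldType) (N : nat).

Lemma exists_perp (U : {vspace 'rV[R]_N}) : (\dim U < N)%N ->
  exists2 a : 'rV[R]_N, a != 0 & forall f, f \in U -> f *m a^T = 0.
Proof.
move=> UN; pose M := \matrix_(i < \dim U) (vbasis U)`_i.
have /rowV0Pn[a aM a0] : kermx M^T != 0.
  rewrite kermx_eq0 /row_free mxrank_tr neq_ltn.
  by rewrite (leq_ltn_trans (rank_leq_row M) UN).
exists a => // f /coord_vbasis ->.
have {}aM : M *m a^T = 0 by apply: trmx_inj; rewrite trmx_mul trmxK trmx0 (sub_kermxP aM).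
rewrite mulmx_suml big1 // => i _; rewrite -scalemxAl.
have -> : (vbasis U)`_i = row i M by rewrite rowK.
by rewrite -row_mul aM row0 scaler0.
Qed.
End Perp.

Section Neighborly.
Variables (R : realFieldType) (N : nat) (L : {vspace 'rV[R]_N}).
Implicit Types (A B I J H S X : {set 'I_N}) (c e f g a : 'rV[R]_N) (i b x u w : 'I_N).
Local Notation ann := (ann L).
Local Notation facets := (facets L).

Definition neighborly_on k A := forall S, S \subset A -> #|S| = k -> iface L A S.

Lemma neighborly_on_sub k A B : B \subset A -> neighborly_on k A -> neighborly_on k B.
Proof.
move=> BA kA S SB Sk; have [c cL [c0 cS]] := kA S (subset_trans SB BA) Sk.
exists c => //; split=> [i iB|]; first exact/c0/(subsetP BA).
apply/setP => i; rewrite -cS !inE; case: (boolP (i \in B)) => iB /=.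
  by rewrite (subsetP BA).
apply/esym/negP => iS; case/negP: iB; apply: (subsetP SB).
by rewrite -cS inE.
Qed.

Definition incl X : 'M[R]_(N, #|X|) := \matrix_(i, j) (i == enum_val j)%:R.
Definition restr_lfun X : 'Hom('rV[R]_N, 'rV[R]_#|X|) := linfun (mulmxr (incl X)).

Lemma restr_lfunE X f j : restr_lfun X f 0 j = f 0 (enum_val j).
Proof.
rewrite lfunE /= mxE (bigD1 (enum_val j)) //= mxE eqxx mulr1 big1 ?addr0 // => i ij.
by rewrite mxE (negPf ij) mulr0.
Qed.

(** Rank-nullity: [ann X] is the kernel on [L] of restriction to [X]. *)
Lemma dim_restr X : (\dim (ann X) + \dim (restr_lfun X @: L) = \dim L)%N.
Proof.
rewrite -(limg_ker_dim (restr_lfun X) L); congr (\dim _ + _)%N.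
apply/vspaceP => f; rewrite [RHS]memv_cap memv_ker; apply/annP/andP => -[fL fX]; split=> //.
  by apply/eqP/rowP => j; rewrite restr_lfunE mxE fX // enum_valP.
move=> i iX; move/eqP/rowP/(_ (enum_rank_in iX i)): fX.
by rewrite restr_lfunE mxE enum_rankK_in.
Qed.

Lemma dim_leq_ann_card X : (\dim L <= \dim (ann X) + #|X|)%N.
Proof.
rewrite -(dim_restr X) leq_add2l; apply: leq_trans (dimvS (subvf _)) _.
by rewrite dimvf /dim /= mul1n.
Qed.

(** When [L] is the space of affine functionals, this is an affine dependence of the points. *)
Definition dependency a := forall f, f \in L -> \sum_i f 0 i * a 0 i = 0.

Lemma dependencyN a : dependency a -> dependency (- a).
Proof.
move=> da f /da E; apply/eqP; rewrite -oppr_eq0 -sumrN -[X in _ == X]E; apply/eqP.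
by apply: eq_bigr => i _; rewrite mxE mulrN opprK.
Qed.

(** The restrictions of [L] to [X] form a proper subspace; a vector orthogonal to it is extended by
    zero. *)
Lemma exists_dependency X : (\dim L < \dim (ann X) + #|X|)%N ->
  exists2 a, a != 0 & dependency a /\ forall i, i \notin X -> a 0 i = 0.
Proof.
rewrite -(dim_restr X) ltn_add2l => /exists_perp[b b0 bP].
exists (b *m (incl X)^T).
  apply: contra b0 => /eqP a0; apply/eqP/rowP => j.
  move/rowP/(_ (enum_val j)): a0; rewrite !mxE (bigD1 j) //= !mxE eqxx mulr1 big1 ?addr0 //.
  by move=> l lj; rewrite !mxE (inj_eq enum_val_inj) eq_sym (negPf lj) mulr0.
split=> [f fL|i iX].
  have := bP _ (memv_img (restr_lfun X) fL); rewrite lfunE /= => E.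
  have /matrixP/(_ 0 0) : f *m (b *m (incl X)^T)^T = 0 by rewrite trmx_mul trmxK mulmxA.
  rewrite mxE [RHS]mxE => {}E; rewrite -[RHS]E.
  by apply: eq_bigr => i _; rewrite [X in _ = _ * X]mxE.
rewrite mxE big1 // => j _; rewrite !mxE; case: eqP iX => [->|]; rewrite ?enum_valP ?mulr0 //.
Qed.

Definition pos_part a := [set i | 0 < a 0 i].

(** If [a_b < 0], enlarge the positive part to a [k]-set [S] avoiding [b]. The functional exposing
    [S] kills the positive terms and is positive at [b], so its pairing with [a] is negative instead
    of zero. *)
Lemma dependency_no_neg k A a : neighborly_on k A -> (k < #|A|)%N -> dependency a ->
  (forall i, i \notin A -> a 0 i = 0) -> (#|pos_part a| <= k)%N ->
  forall b, 0 <= a 0 b.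
Proof.
move=> kA kltA da aA ak b; rewrite leNgt; apply/negP => ab.
have bA : b \in A by apply/contraT => /aA E; move: ab; rewrite E ltxx.
have [||S aS [Sb Sk]] := @card_between _ (pos_part a) (A :\ b) k.
- apply/subsetP => i; rewrite !inE => ai; apply/andP; split.
    by apply: contraTneq ai => ->; rewrite -leNgt ltW.
  by apply/contraT => /aA E; move: ai; rewrite E ltxx.
- by rewrite ak /=; move: kltA; rewrite (cardsD1 b A) bA.
have bS : b \notin S by apply: contraTN isT => /(subsetP Sb); rewrite !inE eqxx.
have [c cL [c0 cS]] := kA S (subset_trans Sb (subsetDl _ _)) Sk.
have cb : 0 < c 0 b.
  by rewrite lt_neqAle c0 // andbT eq_sym; apply: contra bS => cb; rewrite -cS inE bA.
have := da c cL; rewrite (bigD1 b) //=.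
have : c 0 b * a 0 b < 0 by rewrite pmulr_rlt0.
have : \sum_(i | i != b) c 0 i * a 0 i <= 0; last by lra.
apply: sumr_le0 => i _; have [iA|/aA ->] := boolP (i \in A); last by rewrite mulr0.
have [iS|iS] := boolP (i \in S); first by move: iS; rewrite -cS inE => /andP[_ /eqP ->]; rewrite mul0r.
rewrite mulr_ge0_le0 ?c0 // leNgt; apply: contra iS => ai.
by apply: (subsetP aS); rewrite inE.
Qed.

(** A small positive part forces [a >= 0]; then [- a] has empty positive part, hence [- a >= 0]
    too. *)
Lemma dependency_pos_part k A a : neighborly_on k A -> (k < #|A|)%N -> dependency a ->
  (forall i, i \notin A -> a 0 i = 0) -> a != 0 -> (k < #|pos_part a|)%N.
Proof.
move=> kA kltA da aA a0; rewrite ltnNge; apply/negP => ak.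
have age0 := dependency_no_neg kA kltA da aA ak.
have aA' i : i \notin A -> (- a) 0 i = 0 by move=> /aA E; rewrite mxE E oppr0.
have a'0 : #|pos_part (- a)| = 0%N.
  by apply: eq_card0 => i; rewrite inE mxE oppr_gt0 ltNge age0.
have := dependency_no_neg kA kltA (dependencyN da) aA'; rewrite a'0 => /(_ isT) a'ge0.
case/eqP: a0; apply/rowP => i; rewrite mxE; apply/eqP; rewrite eq_le age0 andbT.
by have := a'ge0 i; rewrite mxE oppr_ge0.
Qed.

(* Radon's theorem: more than [2k] points of rank at most [2k] have a
   dependency whose positive or negative part has at most [k] elements. *)
Lemma neighborly_card k A : neighborly_on k A -> (\dim L <= \dim (ann A) + 2 * k)%N ->
  (#|A| <= 2 * k)%N.
Proof.
move=> kA dA; rewrite leqNgt; apply/negP => ltA.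
have [||X _ [XA Xk]] := @card_between _ set0 A (2 * k).+1; rewrite ?sub0set ?cards0 //.
have dX : (\dim L < \dim (ann X) + #|X|)%N.
  by rewrite Xk addnS ltnS; apply: leq_trans dA _; rewrite leq_add2r dimvS // annS.
have [a a0 [da aX]] := exists_dependency dX.
have aA i : i \notin A -> a 0 i = 0 by move=> iA; rewrite aX //; apply: contra iA; apply: subsetP.
have kltA : (k < #|A|)%N by lia.
have p1 := dependency_pos_part kA kltA da aA a0.
have p2 : (k < #|pos_part (- a)|)%N.
  apply: (dependency_pos_part kA) => //; rewrite ?oppr_eq0 //; first exact: dependencyN.
  by move=> i iA; rewrite mxE aA ?oppr0.
have : (#|pos_part a :|: pos_part (- a)| <= #|X|)%N.
  apply/subset_leq_card/subsetP => i; rewrite !inE mxE => h.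
  by apply/contraT => /aX E; move: h; rewrite E oppr0 ltxx.
have := cardsUI (pos_part a) (pos_part (- a)).
rewrite [X in (_ + X)%N](_ : _ = 0%N); first by lia.
apply: eq_card0 => i; rewrite !inE mxE oppr_gt0; apply/negP => /andP[h1 h2].
by have := lt_trans h1 h2; rewrite ltxx.
Qed.

Definition facets_over A S := [set J in facets A | S \subset J].

Lemma card_facets_over k r A S : neighborly_on k A -> S \subset A -> #|S| = k ->
  (\dim L = \dim (ann A) + r)%N -> (r <= k + #|facets_over A S|)%N.
Proof.
move=> kA SA Sk dA; have := leq_dim_ann_facets (kA S SA Sk).
by have := dim_leq_ann_card S; rewrite Sk dA /facets_over; lia.
Qed.

Lemma facets_double_count k A :
  (\sum_(J in facets A) 'C(#|J|, k) =
   \sum_(S : {set 'I_N} | (S \subset A) && (#|S| == k)) #|facets_over A S|)%N.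
Proof.
transitivity (\sum_(J in facets A) \sum_(S : {set 'I_N} | (S \subset J) && (#|S| == k)) 1)%N.
  by apply: eq_bigr => J _; rewrite sum1dep_card cards_draws.
rewrite (exchange_big_dep (fun S : {set 'I_N} => (S \subset A) && (#|S| == k))) /=.
  apply: eq_bigr => S /andP[SA Sk]; rewrite sum1dep_card; apply: eq_card => J.
  by rewrite !inE Sk andbT.
by move=> J S /facet_sub JA /andP[SJ ->]; rewrite (subset_trans SJ).
Qed.

Lemma sum_bin_facets k j A : neighborly_on k A -> (\dim L = \dim (ann A) + (k + j))%N ->
  (j * 'C(#|A|, k) <= \sum_(J in facets A) 'C(#|J|, k))%N.
Proof.
move=> kA dA; rewrite facets_double_count -cards_draws -sum1dep_card big_distrr /=.
apply: leq_sum => S /andP[SA /eqP Sk]; rewrite muln1.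
by have := card_facets_over kA SA Sk dA; rewrite leq_add2l.
Qed.

Lemma facet_dimL r A J : (\dim L = \dim (ann A) + r.+1)%N -> J \in facets A ->
  (\dim L = \dim (ann J) + r)%N.
Proof. by move=> dA /facet_dim ->; rewrite dA; lia. Qed.

Lemma facets_ffact k j A : neighborly_on k A ->
  (\dim L = \dim (ann A) + (2 * k + j))%N ->
  ((k + j)`! * 'C(#|A|, k) <= #|facets A| ^_ j * ('C(2 * k, k) * k`!))%N.
Proof.
elim: j A => [|j IHj] A kA dA.
  rewrite addn0 ffactn0 mul1n mulnC leq_pmul2r ?fact_gt0 // leq_bin2l //.
  by apply: neighborly_card kA _; rewrite dA; lia.
have h := @sum_bin_facets k (k + j.+1) A kA ltac:(rewrite dA; lia).
(* Without facets the double count gives ['C(#|A|, k) = 0], and the left side vanishes. *)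
have [E|[J0 J0F]] := set_0Vmem (facets A).
  move: h; rewrite E big_set0 leqn0 muln_eq0 addnS /= => /eqP ->.
  by rewrite muln0.
case: (@arg_maxnP _ J0 (fun J => J \in facets A) (fun J => #|J|) J0F) => J JF Jmax.
have {}h : ((k + j.+1) * 'C(#|A|, k) <= #|facets A| * 'C(#|J|, k))%N.
  apply: leq_trans h _; rewrite -sum_nat_const; apply: leq_sum => H HF.
  exact/leq_bin2l/Jmax.
rewrite addnS in dA.
have hJ := IHj J (neighborly_on_sub (facet_sub JF) kA) (facet_dimL dA JF).
have fJ := ltn_card_facets JF.
have -> : ((k + j.+1)`! = (k + j.+1) * (k + j)`!)%N by rewrite addnS factS.
(* [h] supplies the first factor of the falling factorial; the other [j] factors start at
   [#|facets A| - 1], which bounds [#|facets J|]. *)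
rewrite mulnAC ffactnS -[X in (_ <= X)%N]mulnA; apply: leq_trans (leq_mul h (leqnn _)) _.
rewrite -mulnA leq_mul // mulnC; apply: leq_trans hJ _.
by rewrite leq_mul // leq_ffact; lia.
Qed.
End Neighborly.

(** * The equality case *)

Section Equality.
Variables (R : realFieldType) (N : nat) (L : {vspace 'rV[R]_N}).
Implicit Types (A B I J H S X G : {set 'I_N}) (c e f g a : 'rV[R]_N) (i b x u w : 'I_N).
Local Notation ann := (ann L).
Local Notation facets := (facets L).
Local Notation neighborly_on := (neighborly_on L).

(** The hypothesis says that [G] has as many points as its rank, so [G] is a simplex: a functional
    vanishing on [G :\ u] and equal to 1 at [u] exists. *)
Lemma facet_del A G u : \dim L = (\dim (ann A) + #|G|.+1)%N -> G \in facets A -> u \in G ->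
  G :\ u \in facets G.
Proof.
move=> dA GF uG; have dG := facet_dimL dA GF.
have Gu : #|G| = #|G :\ u|.+1 by rewrite (cardsD1 u G) uG.
have := dim_leq_ann_card L (G :\ u); rewrite dG [X in (_ + X)%N]Gu addnS ltn_add2r => dlt.
have /subvPn[e /annP[eL e0] eG] : ~~ (ann (G :\ u) <= ann G)%VS.
  by apply: contraL dlt => /dimvS; rewrite -leqNgt.
have eu : e 0 u != 0.
  apply: contra eG => /eqP eu; apply/annP; split=> // i iG.
  by have [->//|iu] := eqVneq i u; rewrite e0 // !inE iu.
pose g := (e 0 u)^-1 *: e.
have gu : g 0 u = 1 by rewrite mxE mulVf.
have gL : g \in L by rewrite memvZ.
have g0 i : i \in G -> i != u -> g 0 i = 0 by move=> iG iu; rewrite mxE (e0 i) ?mulr0 // !inE iu.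
rewrite inE; apply/andP; split.
  apply/asboolP; exists g => //; split=> [i iG|].
    by have [->|iu] := eqVneq i u; rewrite ?gu ?ler01 // g0.
  apply/setP => i; rewrite !inE; have [->|iu] := eqVneq i u.
    by rewrite gu uG oner_eq0.
  by case: (boolP (i \in G)) => //= iG; rewrite g0 ?eqxx.
rewrite eqn_leq dlt andbT.
have : (ann (G :\ u) <= ann G + <[g]>)%VS.
  apply/subvP => h /annP[hL h0]; have -> : h = (h - h 0 u *: g) + h 0 u *: g by rewrite subrK.
  apply: memv_add; last by rewrite memvZ ?memv_line.
  apply/annP; split; first by rewrite memvB ?memvZ.
  move=> i iG; have [->|iu] := eqVneq i u; first by rewrite 3!mxE gu mulr1 subrr.
  have hi : h 0 i = 0 by rewrite h0 // !inE iu.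
  by rewrite mxE hi 2!mxE g0 // mulr0 oppr0 addr0.
move/dimvS/leq_trans; apply; apply: leq_trans (dimv_add_leqif _ _) _.
by rewrite dim_vline -[X in (_ <= X)%N]addn1 leq_add2l leq_b1.
Qed.

Section Base.
Variables (k : nat) (A : {set 'I_N}).
Hypotheses (k2 : (1 < k)%N) (kA : neighborly_on k A).
Hypothesis dA : \dim L = (\dim (ann A) + (2 * k).+1)%N.

(** The rank bounds the size from below and Radon's theorem from above, so all facets of [A] are
    simplices. *)
Lemma card_facet_base J : J \in facets A -> #|J| = (2 * k)%N.
Proof.
move=> JF; have dJ := facet_dimL dA JF; apply/eqP; rewrite eqn_leq.
rewrite (@neighborly_card _ _ L) //=; last by rewrite dJ.
  by have := dim_leq_ann_card L J; rewrite dJ leq_add2l.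
exact: neighborly_on_sub (facet_sub JF) kA.
Qed.

(** The second facet through [G :\ u] has as many points as [G], hence exactly one new point. *)
Lemma facet_swap G u : G \in facets A -> u \in G ->
  exists2 w, w \notin G & (w |: (G :\ u)) \in facets A.
Proof.
move=> GF uG; have cG := card_facet_base GF.
have [|H HF [HG E]] := adjacent_facet GF (@facet_del A G u _ GF uG).
  by rewrite cG.
have cH := card_facet_base HF.
have /eqP/cards1P[w Hw] : #|H :\: G| = 1%N.
  have := cardsID G H; have := cardsD1 u G; rewrite uG E cH cG => ->.
  by move/eqP; rewrite addnC eqn_add2r => /eqP.
exists w; first by have := set11 w; rewrite -Hw inE => /andP[].
by rewrite -E -Hw setUC setID.
Qed.

Hypothesis tight : forall S, S \subset A -> #|S| = k -> #|facets_over L A S| = k.+1.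

(* By tightness, the facets over a [k]-set [S] of [G] are [G] and the swaps of
   the elements of [G :\: S]; so the swap at [u'] of the swap [w |: (G :\ u)] is
   the swap of [G] at [u'], which therefore contains [w]. *)
Lemma facet_swap_unique G u u' w w' : G \in facets A -> u \in G -> u' \in G -> u != u' ->
  w \notin G -> w' \notin G -> w |: (G :\ u) \in facets A -> w' |: (G :\ u') \in facets A ->
  w = w'.
Proof.
move=> GF uG u'G uu' wG w'G WF W'F.
have cG := card_facet_base GF.
have [v vP] : exists v : 'I_N -> 'I_N, forall x, x \in G ->
    v x \notin G /\ (v x |: (G :\ x)) \in facets A.
  suff : forall x, exists y, x \in G -> y \notin G /\ (y |: (G :\ x)) \in facets A.
    by move=> /choice[v vP]; exists v.
  move=> x; have [xG|xG] := boolP (x \in G); last by exists x.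
  by have [y ? ?] := facet_swap GF xG; exists y.
suff key x x' y : x \in G -> x' \in G -> x != x' -> y \notin G -> y |: (G :\ x) \in facets A ->
    y = v x'.
  have -> := key u u' w uG u'G uu' wG WF.
  have [v'G v'F] := vP _ u'G; have [vG vF] := vP _ uG.
  rewrite (key u' u w' u'G uG _ w'G W'F) 1?eq_sym //.
  by rewrite -(key u u' (v u) uG u'G uu' vG vF).
move=> xG x'G xx' yG YF.
pose Phi z := v z |: (G :\ z).
have notPhi z : z \in G -> z \notin Phi z.
  move=> zG; have [vG _] := vP _ zG; rewrite !inE eqxx /= orbF.
  by apply: contraNneq vG => <-.
have inPhi z z' : z \in G -> z != z' -> z \in Phi z' by move=> zG zz'; rewrite !inE zz' zG orbT.
(* Such an [S] fits in [G] minus two points because [k <= 2k - 2], that is [k >= 2]. *)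
have [||S _ [SG Sk]] := @card_between _ set0 (G :\ x :\ x') k; rewrite ?sub0set ?cards0 //=.
  have E1 : #|G :\ x| = (2 * k).-1 by move: (cardsD1 x G); rewrite xG cG => ->.
  have E2 : #|G :\ x :\ x'| = (2 * k).-2.
    by move: (cardsD1 x' (G :\ x)); rewrite E1 in_setD1 x'G eq_sym xx' => /= ->.
  by rewrite E2; clear - k2; lia.
have SG' : S \subset G by apply: subset_trans SG _; rewrite !subDset; apply/subsetP => z; rewrite !inE => ->; rewrite !orbT.
have nS z : z \in S -> z != x /\ z != x'.
  by move/(subsetP SG); rewrite !inE => /and3P[-> ->].
have SA : S \subset A := subset_trans SG' (facet_sub GF).
(* [D] consists of [k + 1] distinct facets over [S], so by tightness it contains all of them. *)
pose D := G |: [set Phi z | z in G :\: S].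
have DE : D = facets_over L A S.
  apply/eqP; rewrite eqEcard; apply/andP; split.
    apply/subsetP => J; rewrite in_setU1 => /orP[/eqP ->|/imsetP[z zG ->]].
      by rewrite inE GF.
    move: zG; rewrite inE => /andP[zS zG]; rewrite in_set (vP _ zG).2 /=.
    apply/subsetP => s sS; rewrite inPhi ?(subsetP SG') //.
    by apply: contraNneq zS => <-.
  rewrite tight // cardsU1 card_in_imset.
    rewrite cardsDS // cG Sk; suff -> : G \notin [set Phi z | z in G :\: S] by clear - k2; lia.
    apply/imsetP => -[z]; rewrite inE => /andP[_ zG] E.
    by have := notPhi z zG; rewrite -E zG.
  move=> z z'; rewrite !inE => /andP[_ zG] /andP[_ z'G] E.
  by apply/eqP; apply: contraNT (notPhi z zG) => zz'; rewrite E inPhi.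
pose G' := y |: (G :\ x).
have x'G' : x' \in G' by rewrite !inE x'G (eq_sym x' x) xx' orbT.
have [w2 w2G' HF] := facet_swap YF x'G'.
set H := w2 |: _ in HF.
have x'H : x' \notin H.
  rewrite !inE eqxx /= orbF; apply: contraNneq w2G' => <-; exact: x'G'.
have yH : y \in H.
  have yx' : y != x' by apply: contraNneq yG => ->.
  by rewrite !inE eqxx yx' orbT.
have : H \in facets_over L A S.
  rewrite in_set HF /=; apply/subsetP => s sS; have [sx sx'] := nS s sS.
  by rewrite !inE sx' sx (subsetP SG' s sS) !orbT.
rewrite -DE in_setU1 => /orP[/eqP E|/imsetP[z zG E]].
  by move: yG; rewrite -E yH.
have zx' : x' = z.
  by apply/eqP; apply: contraNT x'H => zx'; rewrite E inPhi.
by move: yH; rewrite E -zx' !inE (negPf yG) andbF orbF => /eqP.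
Qed.

(* The common swap [w] completes [G] to a simplex [B] all of whose facets are
   facets of [A]; a further point of [A] would be a nonnegative combination of
   [B], a dependency with a single element of one sign. *)
Lemma base_card : facets A != set0 -> #|A| = (2 * k).+1.
Proof.
case/set0Pn => G GF; have cG := card_facet_base GF.
have [u0 u0G] : exists u, u \in G by apply/card_gt0P; rewrite cG; clear - k2; lia.
have [w wG WF] := facet_swap GF u0G.
pose B := w |: G.
have BF b : b \in B -> B :\ b \in facets A.
  rewrite in_setU1 => /orP[/eqP ->|bG].
    by rewrite /B setU1K.
  have bw : b != w by apply: contraNneq wG => <-.
  have [y yG YF] := facet_swap GF bG.
  have -> : B :\ b = w |: (G :\ b).
    apply/setP => z; rewrite !inE; have [->|] //= := eqVneq z b.
    by rewrite (negPf bw).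
  have [E|bu0] := eqVneq u0 b; first by rewrite -E.
  by rewrite (facet_swap_unique GF u0G bG bu0 wG yG WF YF).
have cB : #|B| = (2 * k).+1 by rewrite cardsU1 wG cG.
have BA : B \subset A.
  rewrite subUset (facet_sub GF) andbT sub1set (subsetP (facet_sub WF)) //.
  by rewrite !inE eqxx.
rewrite -cB; congr #|pred_of_set _|; apply/eqP; rewrite eqEsubset BA andbT.
apply/subsetP => x xA; apply/contraT => xB.
pose X := x |: B.
have XA : X \subset A by rewrite subUset sub1set xA.
have dX : (\dim L < \dim (ann X) + #|X|)%N.
  by rewrite cardsU1 xB cB dA add1n [X in (_ < X)%N]addnS ltnS leq_add2r dimvS // annS.
have [a a0 [da aX]] := exists_dependency dX.
have kltA : (k < #|A|)%N by have := subset_leq_card BA; rewrite cB; clear - k2; lia.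
have aA i : i \notin A -> a 0 i = 0.
  by move=> iA; apply: aX; apply: contra iA; apply: subsetP.
(* A positive part inside [[set x]] has at most one element, but it must have more than [k >= 2]. *)
have xfalse a' : a' != 0 -> dependency L a' -> (forall i, i \notin A -> a' 0 i = 0) ->
    pos_part a' \subset [set x] -> False.
  move=> a'0 da' a'A /subset_leq_card; rewrite cards1.
  move=> c1; have := leq_trans k2 (ltnW (leq_trans (dependency_pos_part kA kltA da' a'A a'0) c1)).
  by [].
(* Pair [a] with the functional exposing [B :\ b]: only the terms at [b] and [x] survive, so [a_b]
   and [a_x] cannot have the same strict sign. *)
have aB b : b \in B -> exists2 t, 0 <= t & a 0 b = - (t * a 0 x).
  move=> bB; have [g gL [g0 gB _]] := facetsP (BF b bB).
  have bA := subsetP BA b bB.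
  have gb : 0 < g 0 b.
    rewrite lt_neqAle g0 // andbT eq_sym; apply/negP => gb.
    by have : b \in B :\ b; [rewrite -gB inE bA | rewrite !inE eqxx].
  have bx : b != x by apply: contraNneq xB => <-.
  have := da g gL; rewrite (bigD1 b) //= (bigD1 x) 1?eq_sym //= big1 ?addr0; last first.
    move=> i /andP[ib ix]; have [iB|iB] := boolP (i \in B).
      have : i \in B :\ b by rewrite in_setD1 ib iB.
      by rewrite -gB inE => /andP[_ /eqP ->]; rewrite mul0r.
    by rewrite (aX i) ?mulr0 // in_setU1 negb_or ix iB.
  move=> E; exists (g 0 x / g 0 b); first by rewrite divr_ge0 ?g0.
  apply: (mulfI (lt0r_neq0 gb)); rewrite mulrN mulrA mulrCA divff ?lt0r_neq0 // mulr1; lra.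
have outX i : i != x -> i \notin B -> a 0 i = 0.
  by move=> ix iB; apply: aX; rewrite in_setU1 negb_or ix iB.
have sgn a' i : (a' = a \/ a' = - a) -> 0 <= a' 0 x -> 0 < a' 0 i -> i == x.
  move=> aa' a'x; apply: contraLR => ix; rewrite -leNgt.
  have [iB|iB] := boolP (i \in B); last by case: aa' => ->; rewrite ?mxE outX ?oppr0.
  have [t t0 E] := aB i iB; have := mulr_ge0 t0 a'x.
  by case: aa' => -> ; rewrite ?mxE E; lra.
exfalso; have [ax|ax] := leP 0 (a 0 x).
  apply: (xfalse a) => //; apply/subsetP => i; rewrite !inE.
  by apply: sgn ax; left.
apply: (xfalse (- a)); rewrite ?oppr_eq0 //; first exact: dependencyN.
  by move=> i iA; rewrite mxE aA ?oppr0.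
apply/subsetP => i; rewrite !inE; apply: sgn; first by right.
by rewrite mxE oppr_ge0 ltW.
Qed.

End Base.

Lemma base_equality k A : (1 < k)%N -> neighborly_on k A ->
  \dim L = (\dim (ann A) + (2 * k).+1)%N -> (k <= #|A|)%N ->
  (k.+1 * 'C(#|A|, k) = #|facets A| * 'C(2 * k, k))%N -> #|facets A| = (2 * k).+1.
Proof.
move=> k2 kA dA kleA E.
have Cpos : (0 < 'C(2 * k, k))%N by rewrite bin_gt0; lia.
have F0 : facets A != set0.
  rewrite -card_gt0 lt0n; apply/eqP => f0; move: E; rewrite f0 mul0n => /eqP.
  by rewrite muln_eq0 /= -leqn0 leqNgt bin_gt0 kleA.
have tight S : S \subset A -> #|S| = k -> #|facets_over L A S| = k.+1.
  have dA' : (\dim L = \dim (ann A) + (k + k.+1))%N by rewrite dA; lia.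
  have ge1 (T : {set 'I_N}) : (T \subset A) && (#|T| == k) ->
      (k.+1 <= #|facets_over L A T| ?= iff (k.+1 == #|facets_over L A T|))%N.
    move=> /andP[TA /eqP Tk]; split=> //.
    by have := card_facets_over kA TA Tk dA'; rewrite leq_add2l.
  have EJ : (\sum_(J in facets A) 'C(#|J|, k) = #|facets A| * 'C(2 * k, k))%N.
    by rewrite -sum_nat_const; apply: eq_bigr => J JF; rewrite (card_facet_base kA dA JF).
  have ES : (\sum_(T : {set 'I_N} | (T \subset A) && (#|T| == k)) k.+1 = k.+1 * 'C(#|A|, k))%N.
    by rewrite -cards_draws -sum1dep_card big_distrr; apply: eq_bigr => T _; rewrite /= muln1.
  (* Equal totals force equality in every term of the sum over [k]-sets. *)
  have /leqifP := leqif_sum ge1; rewrite -facets_double_count EJ ES E.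
  case: ifP => [/forallP h _|_]; last by rewrite ltnn.
  by move=> SA Sk; have := h S; rewrite SA Sk eqxx /= => /eqP.
have cA := base_card k2 kA dA tight F0.
apply/eqP; rewrite -(eqn_pmul2r Cpos) -E cA.
(* With [2k + 1] points, [(k + 1) C(2k + 1, k) = (2k + 1) C(2k, k)] reads off the number of
   facets. *)
have := mul_bin_down (2 * k).+1 k; rewrite /= => ->.
by apply/eqP; congr (_ * _)%N; lia.
Qed.

(** Equality passes to a largest facet [J]: cancelling one factor [f = #|facets A|] leaves [(f - 1)
    ^_ (j + 1) <= #|facets J| ^_ (j + 1)] in the inductive step, while [#|facets J| <= f - 1]; so
    [J] has [f - 1] facets and is itself an equality case. *)
Lemma facets_ffact_equality k j A : (1 < k)%N -> neighborly_on k A ->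
  (\dim L = \dim (ann A) + (2 * k + j.+1))%N ->
  ((k + j.+1)`! * 'C(#|A|, k) = #|facets A| ^_ j.+1 * ('C(2 * k, k) * k`!))%N ->
  #|facets A| = (2 * k + j.+1)%N.
Proof.
move=> k2; elim: j A => [|j IHj] A kA dA.
  rewrite addn1 factS ffactn1 mulnAC mulnA => /eqP; rewrite eqn_pmul2r ?fact_gt0 // => /eqP E.
  rewrite addn1; apply: (base_equality k2 kA) => //; rewrite ?dA ?addn1 //.
  by have := dim_leq_ann_card L A; rewrite dA; lia.
have kleA : (k <= #|A|)%N by have := dim_leq_ann_card L A; rewrite dA; lia.
have h := @sum_bin_facets _ _ L k (k + j.+2) A kA ltac:(rewrite dA; lia).
have Apos : (0 < 'C(#|A|, k))%N by rewrite bin_gt0.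
have Xpos : (0 < 'C(2 * k, k) * k`!)%N by rewrite muln_gt0 fact_gt0 bin_gt0; lia.
have [E|[J0 J0F]] := set_0Vmem (facets A).
  by move: h; rewrite E big_set0 leqn0 muln_eq0; lia.
case: (@arg_maxnP _ J0 (fun J => J \in facets A) (fun J => #|J|) J0F) => J JF Jmax.
have {}h : ((k + j.+2) * 'C(#|A|, k) <= #|facets A| * 'C(#|J|, k))%N.
  apply: leq_trans h _; rewrite -sum_nat_const; apply: leq_sum => H HF.
  exact/leq_bin2l/Jmax.
rewrite addnS in dA; have dJ := facet_dimL dA JF.
have kJ := neighborly_on_sub (facet_sub JF) kA.
have hJ := facets_ffact kJ dJ.
have fJ := ltn_card_facets JF.
have -> : ((k + j.+2)`! = (k + j.+2) * (k + j.+1)`!)%N by rewrite addnS factS.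
rewrite mulnAC ffactnS -[X in (_ = X)%N -> _]mulnA => E.
have fpos : (0 < #|facets A|)%N by apply: leq_ltn_trans fJ.
have le1 : ((k + j.+1)`! * 'C(#|J|, k) >= #|facets A|.-1 ^_ j.+1 * ('C(2 * k, k) * k`!))%N.
  by rewrite -(leq_pmul2l fpos) -E mulnC [X in (_ <= X)%N]mulnCA leq_mul2l h orbT.
have le2 := leq_trans le1 hJ; rewrite leq_pmul2r // in le2.
have fge : (j.+1 <= #|facets J|)%N.
  rewrite -ffact_gt0 -(ltn_pmul2r Xpos) mul0n; apply: leq_trans hJ.
  rewrite muln_gt0 fact_gt0 bin_gt0; have := dim_leq_ann_card L J; rewrite dJ; lia.
have eqf : #|facets J| = #|facets A|.-1.
  apply/eqP; rewrite eqn_leq; apply/andP; split; first by lia.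
  rewrite leqNgt; apply: contraL le2 => lt; rewrite -ltnNge ltn_ffact //; lia.
have EJ : ((k + j.+1)`! * 'C(#|J|, k) = #|facets J| ^_ j.+1 * ('C(2 * k, k) * k`!))%N.
  by apply/eqP; rewrite eqn_leq hJ eqf le1.
have := IHj J kJ dJ EJ; rewrite eqf => f1.
by rewrite -(prednK fpos) f1 !addnS.
Qed.

Theorem card_facets_neighborly k d A : (2 * k < d)%N -> (d <= 3 * k - 1)%N ->
  neighborly_on k A -> \dim L = (\dim (ann A) + d.+1)%N ->
  (#|A| <= #|facets A|)%N /\ (#|facets A| = #|A| -> #|A| = d.+1).
Proof.
move=> kd dk kA dA.
have dltA : (d < #|A|)%N by have := dim_leq_ann_card L A; rewrite dA leq_add2l.
have k2 : (1 < k)%N by lia.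
have dA' : \dim L = (\dim (ann A) + (2 * k + (d.+1 - 2 * k)))%N by rewrite subnKC // ltnW // ltnS ltnW.
have h := facets_ffact kA dA'.
have c := ffact_compare kd dk dltA.
have Ej : (k + (d.+1 - 2 * k) = d.+1 - k)%N by lia.
rewrite Ej in h; split.
  have := leq_trans c h; rewrite leq_pmul2r; last first.
    by rewrite muln_gt0 fact_gt0 bin_gt0; lia.
  apply: contraTT; rewrite -!ltnNge => lt; apply: ltn_ffact => //; lia.
move=> E; rewrite -E.
have Ejj : (d.+1 - 2 * k = (d - 2 * k).+1)%N by lia.
have := @facets_ffact_equality k (d - 2 * k) A k2 kA; rewrite -Ejj Ej => -> //.
- by rewrite subnKC // ltnW // ltnS ltnW.
(* When the two counts agree, [h] and [c] are opposite inequalities. *)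
- by apply/eqP; rewrite eqn_leq h E c.
Qed.
End Equality.

(** * Convex hulls and exposed points *)

From mathcomp Require Import classical_sets cardinality reals convex.
Local Open Scope classical_set_scope.

Section Counting.
Variables (T : finType) (X : choiceType) (g : T -> X).

Lemma leq_card_fset_set (D : {pred T}) (S : set X) : finite_set S ->
  {in D &, injective g} -> (forall t, t \in D -> S (g t)) ->
  (#|D| <= #|` fset_set S|%fset)%N.
Proof.
move=> Sfin ginj gS; rewrite cardE -(size_map g) uniq_leq_size //.
  by rewrite map_inj_in_uniq ?enum_uniq // => x y; rewrite !mem_enum; apply: ginj.
move=> x /mapP[t]; rewrite mem_enum => tD ->.
by rewrite in_fset_set // inE; apply: gS.
Qed.

Lemma card_fset_set_range : injective g -> #|` fset_set (range g)|%fset = #|T|.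
Proof.
move=> ginj; have fin : finite_set (range g) by apply: finite_image; apply: finite_finset.
apply/eqP; rewrite eqn_leq leq_card_fset_set ?andbT //; last by move=> ? ? _ _ /ginj.
rewrite cardE -(size_map g) uniq_leq_size ?fset_uniq // => x.
rewrite in_fset_set // inE => -[t _ <-]; rewrite map_f // mem_enum //.
Qed.
End Counting.

Section Dot.
Variables (R : realType) (n : nat).
Implicit Types (c x y : 'rV[R]_n).

Lemma dotpE c x : dotp c x = (c *m x^T) 0 0.
Proof. by rewrite mxE; apply: eq_bigr => j _; rewrite mxE. Qed.

Lemma dotpDr c x y : dotp c (x + y) = dotp c x + dotp c y.
Proof. by rewrite !dotpE linearD mulmxDr mxE. Qed.

Lemma dotpZr c (t : R) x : dotp c (t *: x) = t * dotp c x.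
Proof. by rewrite !dotpE linearZ -scalemxAr mxE. Qed.

Lemma dotpDl c c' x : dotp (c + c') x = dotp c x + dotp c' x.
Proof. by rewrite !dotpE mulmxDl mxE. Qed.

Lemma dotpZl (t : R) c x : dotp (t *: c) x = t * dotp c x.
Proof. by rewrite !dotpE -scalemxAl mxE. Qed.

Lemma dotp_sumr (I : finType) (F : I -> 'rV[R]_n) c :
  dotp c (\sum_i F i) = \sum_i dotp c (F i).
Proof.
apply: (big_morph (dotp c) (dotpDr c)).
by rewrite /dotp big1 // => j _; rewrite mxE mulr0.
Qed.

End Dot.

(** * Finitely generated cones and Farkas' lemma *)

Section Farkas.
Variables (R : realType) (m : nat).
Implicit Types (x q c : 'rV[R]_m).

Fixpoint cone (s : seq 'rV[R]_m) x : Prop :=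
  if s is q :: s' then exists2 t, 0 <= t & cone s' (x - t *: q) else x = 0.

(* Projecting along [q] onto the hyperplane of a functional [c] with
   [c q < 0] is Fourier-Motzkin elimination of the generator [q]. *)
Lemma farkas s x : cone s x \/
  exists2 c, (forall q, q \in s -> 0 <= dotp c q) & dotp c x < 0.
Proof.
have [l sl] := ubnP (size s); elim: l s x sl => // l IHl [|q s] x /=.
  move=> _; have [->|x0] := eqVneq x 0; [by left|right; exists (- x)] => //.
  rewrite -scaleN1r dotpZl mulN1r oppr_lt0 lt_neqAle eq_sym; apply/andP; split.
    apply: contra x0 => /eqP/psumr_eq0P x0; apply/eqP/rowP => j; rewrite mxE.
    by apply/eqP; rewrite -sqrf_eq0 expr2 x0 // => i _; rewrite -expr2 sqr_ge0.
  by apply: sumr_ge0 => j _; rewrite -expr2 sqr_ge0.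
rewrite ltnS => sl; have [xs|[c cs cx]] := IHl s x sl.
  by left; exists 0; rewrite ?scale0r ?subr0.
have [cq|cq] := leP 0 (dotp c q).
  by right; exists c => // y; rewrite inE => /orP[/eqP ->//|/cs].
pose pr y : 'rV[R]_m := y - (dotp c y / dotp c q) *: q.
(* Since [c] is nonnegative on [s'] and negative at [q], [pr] adds a nonnegative multiple of [q] to
   each generator; [u] collects these multiples. *)
have lift s' y : (forall q', q' \in s' -> 0 <= dotp c q') -> cone (map pr s') y ->
    exists2 u, 0 <= u & cone s' (y - u *: q).
  elim: s' y => [|q' s' IHs'] y cs' /=.
    by move=> ->; exists 0; rewrite // scale0r subr0.
  move=> [t t0 /IHs'[z zs'|u u0 us']]; first by apply: cs'; rewrite inE zs' orbT.
  exists (u - t * (dotp c q' / dotp c q)); last exists t => //.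
    rewrite addr_ge0 // -mulrN mulr_ge0 // -mulrN mulr_ge0 ?cs' ?mem_head //.
    by rewrite oppr_ge0 invr_le0 ltW.
  move: us'; congr (cone _ _); rewrite /pr scalerBr scalerBl scalerA.
  by rewrite !opprB !addrA; apply/rowP => j; rewrite !mxE; ring.
(* Composing [e] with the projection gives a functional that vanishes at [q]. *)
have prE e y : dotp (e - (dotp e q / dotp c q) *: c) y = dotp e (pr y).
  by rewrite dotpDl -scaleNr dotpZl dotpDr -scaleNr dotpZr; ring.
have [/(lift _ _ cs)[u u0 xu]|[e es ex]] := IHl (map pr s) (pr x) ltac:(by rewrite size_map).
  left; exists (dotp c x / dotp c q + u).
    by rewrite addr_ge0 // -mulrNN -invrN mulr_ge0 // ?invr_ge0 oppr_ge0 ltW.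
  by move: xu; rewrite /pr scalerDl opprD addrA.
right; exists (e - (dotp e q / dotp c q) *: c); last by rewrite prE.
move=> y; rewrite prE inE => /orP[/eqP ->|ys]; last by apply: es; rewrite map_f.
by rewrite /pr divff ?lt_eqF // scale1r subrr -(scale0r 0) dotpZr mul0r.
Qed.
End Farkas.

Lemma cone_map (R : realType) (m : nat) (I : eqType) (f : I -> 'rV[R]_m) (r : seq I) x :
  uniq r -> cone (map f r) x ->
  exists2 a : I -> R, (forall i, 0 <= a i) & x = \sum_(i <- r) a i *: f i.
Proof.
elim: r x => [|i r IHr] x /=; first by move=> _ ->; exists (fun=> 0); rewrite ?big_nil.
case/andP=> ir ur [t t0 /(IHr _ ur)[a a0 E]].
exists (fun j => if j == i then t else a j); first by move=> j; case: ifP.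
rewrite big_cons eqxx -(subrK (t *: f i) x) E addrC; congr (_ + _).
by rewrite !big_seq; apply: eq_bigr => j jr; case: eqP jr ir => // -> ->.
Qed.

(** * Convex combinations, supporting inequalities and separation *)

Section Hull.
Variables (R : realType) (n : nat).
Local Notation V := 'rV[R]_n.

Lemma convex_setP (A : set V) : convex_set A <->
  forall x y (t : R), 0 <= t <= 1 -> A x -> A y -> A (t *: x + (1 - t) *: y).
Proof.
split=> [cA x y t /andP[t0 t1] Ax Ay|cA x y t xA yA].
  by have := cA x y (Itv01 t0 t1) (mem_set Ax) (mem_set Ay); rewrite inE.
rewrite inE; move: xA yA; rewrite !inE => xA yA.
by apply: cA => //; apply/andP; split.
Qed.

Definition convex_comb (I : finType) (p : I -> V) (x : V) : Prop :=
  exists a : I -> R, [/\ forall i, 0 <= a i, \sum_i a i = 1 & x = \sum_i a i *: p i].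

Lemma convex_comb_sub (I : finType) (p : I -> V) (C : set V) :
  convex_set C -> (forall i, C (p i)) -> convex_comb p `<=` C.
Proof.
move=> /convex_setP cC Cp x [a [a0 a1 ->]].
(* Partial sums of the weights are not 1, so they are normalised; when the remaining weight is 0,
   all remaining terms vanish. *)
suff H (s : seq I) : 0 < \sum_(i <- s) a i ->
    C ((\sum_(i <- s) a i)^-1 *: \sum_(i <- s) a i *: p i).
  by have := H (index_enum I); rewrite a1 invr1 scale1r => /(_ ltr01).
elim: s => [|i s IHs]; rewrite ?big_nil ?ltxx // !big_cons => as0.
have s0 : 0 <= \sum_(j <- s) a j by apply: sumr_ge0.
have [sgt0|sle0] := ltP 0 (\sum_(j <- s) a j).
  set t := a i / (a i + \sum_(j <- s) a j).
  have t01 : 0 <= t <= 1.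
    by rewrite divr_ge0 ?(ltW as0) //= ler_pdivrMr // mul1r lerDl.
  have := cC _ _ t t01 (Cp i) (IHs sgt0); congr (C _).
  rewrite scalerDr !scalerA; congr (_ *: _ + _ *: _); first by rewrite mulrC.
  by rewrite /t; field; rewrite !gt_eqF.
have sE : \sum_(j <- s) a j = 0 by apply/eqP; rewrite eq_le sle0.
have -> : \sum_(j <- s) a j *: p j = 0.
  rewrite big_seq big1 // => j js; suff -> : a j = 0 by rewrite scale0r.
  by move/eqP: sE; rewrite psumr_eq0 // => /allP/(_ j js)/eqP.
by rewrite sE !addr0 scalerA mulVf ?scale1r //; move: as0; rewrite sE addr0 => /gt_eqF ->.
Qed.

Lemma convex_comb_convex (I : finType) (p : I -> V) : convex_set (convex_comb p).
Proof.
apply/convex_setP => x y t /andP[t0 t1] [a [a0 a1 ->]] [b [b0 b1 ->]].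
exists (fun i => t * a i + (1 - t) * b i); split.
- by move=> i; rewrite addr_ge0 // mulr_ge0 // subr_ge0.
- by rewrite big_split -!mulr_sumr a1 b1 /= !mulr1 addrC subrK.
- rewrite !scaler_sumr -big_split; apply: eq_bigr => i _.
  by rewrite /= !scalerA -scalerDl.
Qed.

Lemma convex_comb_gen (I : finType) (p : I -> V) i : convex_comb p (p i).
Proof.
exists (fun j => (j == i)%:R); split=> [j||].
- by rewrite ler0n.
- by rewrite (bigD1 i) //= eqxx big1 ?addr0 // => j /negPf ->.
- by rewrite (bigD1 i) //= eqxx scale1r big1 ?addr0 // => j /negPf ->; rewrite scale0r.
Qed.

Lemma convex_hullE (I : finType) (p : I -> V) : convex_hull (range p) = convex_comb p.
Proof.
apply/seteqP; split.
  by apply: smallest_sub; [exact: convex_comb_convex|move=> _ [i _ <-]; exact: convex_comb_gen].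
by move=> x px C [cC pC]; apply: convex_comb_sub px => // i; apply: pC; exists i.
Qed.

Lemma convex_comb_le (I : finType) (p : I -> V) x c (b : R) :
  convex_comb p x -> (forall i, dotp c (p i) <= b) -> dotp c x <= b.
Proof.
move=> [a [a0 a1 ->]] cb; rewrite dotp_sumr -[leRHS]mul1r -a1 mulr_suml.
by apply: ler_sum => i _; rewrite dotpZr ler_wpM2l.
Qed.

(** Complementary slackness: the nonnegative terms [a_j (b - c p_j)] add up to 0. *)
Lemma convex_comb_support (I : finType) (p : I -> V) (a : I -> R) c (b : R) :
  (forall i, 0 <= a i) -> \sum_i a i = 1 -> (forall i, dotp c (p i) <= b) ->
  dotp c (\sum_i a i *: p i) = b -> forall i, a i != 0 -> dotp c (p i) = b.
Proof.
move=> a0 a1 cb E i ai; have {}E : \sum_j a j * (b - dotp c (p j)) = 0.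
  under eq_bigr do rewrite mulrBr -dotpZr.
  by rewrite sumrB -mulr_suml a1 mul1r -dotp_sumr E subrr.
have ge0 j : true -> 0 <= a j * (b - dotp c (p j)) by rewrite mulr_ge0 ?subr_ge0.
have /eqP := psumr_eq0P ge0 E (i := i) isT.
by rewrite mulf_eq0 (negPf ai) subr_eq0 => /eqP ->.
Qed.

(** Farkas' lemma for the homogenised points [(1, p_i)]: the extra coordinate encodes both the
    condition that the weights sum to 1 and the offset [b]. *)
Lemma convex_comb_separation N (p : 'I_N -> V) x : ~ convex_comb p x ->
  exists c (b : R), (forall i, dotp c (p i) <= b) /\ b < dotp c x.
Proof.
move=> px; pose h (y : V) : 'rV[R]_(1 + n) := row_mx 1%:M y.
have dotph c y : dotp c (h y) = c 0 (lshift n 0) + dotp (rsubmx c) y.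
  rewrite {1}/dotp big_split_ord big_ord1 /=; congr (_ + _).
    by rewrite row_mxEl mxE eqxx mulr1.
  by apply: eq_bigr => j _; rewrite row_mxEr mxE.
have [hx|[c cp cx]] := farkas [seq h (p i) | i <- enum 'I_N] (h x).
  have [a a0] := cone_map (enum_uniq _) hx; rewrite big_enum => E; case: px.
  exists a; split=> //.
    have /matrixP/(_ 0 (lshift n 0)) := E; rewrite row_mxEl mxE eqxx mulr1n summxE => ->.
    by apply: eq_bigr => i _; rewrite mxE row_mxEl mxE eqxx mulr1.
  have /(congr1 rsubmx) := E; rewrite row_mxKr linear_sum => ->.
  by apply: eq_bigr => i _; rewrite linearZ /= row_mxKr.
exists (- rsubmx c), (c 0 (lshift n 0)); split=> [i|].
  have := cp _ (map_f (fun i => h (p i)) (mem_enum 'I_N i)); rewrite dotph.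
  by rewrite -scaleN1r dotpZl; lra.
by move: cx; rewrite dotph -scaleN1r dotpZl; lra.
Qed.
End Hull.

Section Exposed.
Variables (R : realType) (n : nat).
Local Notation V := 'rV[R]_n.

Lemma convex_comb_drop N (p : 'I_N.+1 -> V) i :
  convex_comb (p \o lift i) (p i) -> convex_comb p = convex_comb (p \o lift i).
Proof.
move=> pi; apply/seteqP; split.
  apply: convex_comb_sub => [|j]; first exact: convex_comb_convex.
  by case: (unliftP i j) => [j' ->|-> //]; exact: (convex_comb_gen (p \o lift i)).
by apply: convex_comb_sub => [|j]; [exact: convex_comb_convex|exact: (convex_comb_gen p)].
Qed.

(* A generating family of least cardinality consists of exposed points. *)
Lemma polytope_vertices (P : set V) : polytope P -> exists N (p : 'I_N -> V),
  [/\ injective p, P = convex_comb p & forall i, face P [set p i]].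
Proof.
case=> A /finite_seqP[s ->] PE.
pose gen N := `[< exists p : 'I_N -> V, P = convex_comb p >].
have exgen : exists N, gen N.
  exists (size s); apply/asboolP; exists (fun i => s`_i).
  rewrite PE -convex_hullE; congr convex_hull; apply/seteqP; split=> x /=.
    move=> xs; have xi : (index x s < size s)%N by rewrite index_mem.
    by exists (Ordinal xi); rewrite //= nth_index.
  by move=> [i _ <-]; rewrite mem_nth.
case: (ex_minnP exgen) => -[|N] /asboolP[p {}PE] Nmin.
  by exists 0%N, p; split=> //; case.
have out i : ~ convex_comb (p \o lift i) (p i).
  move=> pi; suff /Nmin : gen N by rewrite ltnn.
  by apply/asboolP; exists (p \o lift i); rewrite PE (convex_comb_drop pi).
exists N.+1, p; split=> //.
  move=> i j pij; apply/eqP/contraT => ij; case: (out i).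
  have [j' jE|E] := unliftP i j; last by rewrite E eqxx in ij.
  by rewrite pij jE; exact: (convex_comb_gen (p \o lift i)).
move=> i; have [c [b [cb bc]]] := convex_comb_separation (out i).
(* The functional separating [p i] from the other generators attains its maximum over the generators
   only at [p i]. *)
have cj j : dotp c (p j) <= dotp c (p i) ?= iff (j == i).
  case: (unliftP i j) => [j' ->|->]; last by split; rewrite ?eqxx.
  have lt := le_lt_trans (cb j') bc; split; first exact: ltW.
  by rewrite lt_eqF // eq_sym (negPf (neq_lift i j')).
have cle j : dotp c (p j) <= dotp c (p i) := cj j.
exists c, (dotp c (p i)); split.
  by move=> x; rewrite PE => /convex_comb_le; apply.
apply/seteqP; split=> x /=.
  by move=> ->; split=> //; rewrite PE; exact: convex_comb_gen.
rewrite PE => -[[a [a0 a1 ->]]] E.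
have aj j : j != i -> a j = 0.
  move=> ji; apply/eqP; apply: contraNT ji => aj; rewrite -(cj j).2.
  by rewrite (convex_comb_support a0 a1 cle E aj).
rewrite (bigD1 i) //= big1 ?addr0 => [|j /aj ->]; last by rewrite scale0r.
suff -> : a i = 1 by rewrite scale1r.
by rewrite -a1 (bigD1 i) //= big1 ?addr0.
Qed.
End Exposed.

(** * Affine functionals on a point configuration *)

Definition rmul_lfun (R : fieldType) m1 m2 (M : 'M[R]_(m1, m2)) :
  'Hom('rV[R]_m1, 'rV[R]_m2) := linfun (mulmxr M).

Lemma rmul_lfunE (R : fieldType) m1 m2 (M : 'M[R]_(m1, m2)) u : rmul_lfun M u = u *m M.
Proof. by rewrite lfunE. Qed.

Section AffineFunctionals.
Variables (R : realType) (n N : nat) (p : 'I_N -> 'rV[R]_n).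
Local Notation V := 'rV[R]_n.
Implicit Types (i : 'I_N) (I : {set 'I_N}) (F : set V).

Definition affine_values : {vspace 'rV[R]_N} :=
  (<[const_mx 1]> + limg (rmul_lfun (\matrix_i p i)^T))%VS.
Local Notation L := affine_values.

Lemma mul_trmx_dotp m (q : 'I_m -> V) (c : V) (i : 'I_m) : (c *m (\matrix_i q i)^T) 0 i = dotp c (q i).
Proof. by rewrite mxE; apply: eq_bigr => j _; rewrite !mxE. Qed.

Lemma affine_valuesP f :
  f \in L <-> exists c b, forall i, f 0 i = b - dotp c (p i).
Proof.
split=> [/memv_addP[u /vlineP[b ->] [v /memv_imgP[c _ ->] ->]]|[c [b fE]]].
  exists (- c), b => i; rewrite rmul_lfunE !mxE mulr1 -mul_trmx_dotp mulNmx [X in _ - X]mxE opprK.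
  by congr (_ + _); rewrite mxE.
have -> : f = b *: const_mx 1 + (- c) *m (\matrix_i p i)^T.
  by apply/rowP => i; rewrite mxE [X in _ = X + _]mxE mxE mulr1 fE mul_trmx_dotp -[- c]scaleN1r dotpZl mulN1r.
rewrite memv_add ?memvZ ?memv_line //.
have -> : - c *m (\matrix_i p i)^T = (rmul_lfun (\matrix_i p i)^T) (- c) by rewrite lfunE.
by rewrite memv_img ?memvf.
Qed.

Lemma dim_limg_mulmxr m1 m2 (M : 'M[R]_(m1, m2)) :
  \dim (limg (rmul_lfun M)) = \rank M.
Proof.
have -> : limg (rmul_lfun M) = limg (rmul_lfun (row_base M)).
  apply/vspaceP => v; apply/memv_imgP/memv_imgP => -[u _ ->]; rewrite rmul_lfunE.
    have /submxP[w ->] : (u *m M <= row_base M)%MS by rewrite eq_row_base submxMl.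
    by exists w; rewrite ?memvf // lfunE.
  have /submxP[w ->] : (u *m row_base M <= M)%MS by rewrite (submx_trans (submxMl _ _)) ?eq_row_base.
  by exists w; rewrite ?memvf // lfunE.
rewrite limg_dim_eq ?dimvf /dim /= ?mul1n //; apply/eqP; rewrite -subv0; apply/subvP => u.
rewrite memv_cap memv_ker rmul_lfunE => /andP[_ /eqP E]; rewrite memv0.
by rewrite -(mulmx_free_eq0 _ (row_base_free M)) E.
Qed.

(** The direction space of the affine hull of the points of [I], based at [p i0]; zero rows outside
    [I] keep the index type fixed. *)
Definition directions i0 I : {vspace V} :=
  limg (rmul_lfun (\matrix_i (if i \in I then p i - p i0 else 0))).

(** Constants account for one dimension beyond the functionals [L0] vanishing at [i0]. Masking [L0]
    to the coordinates in [I] has kernel [ann L I] and an image whose dimension is the rank of the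
    masked differences. *)
Lemma dim_ann_directions i0 I : i0 \in I ->
  \dim L = (\dim (ann L I) + (\dim (directions i0 I)).+1)%N.
Proof.
move=> i0I; pose D := (\matrix_i (p i - p i0)).
pose L0 := limg (rmul_lfun D^T).
have oneL : const_mx 1 \in L.
  by apply/affine_valuesP; exists 0, 1 => i; rewrite mxE dotpE mul0mx mxE subr0.
have L0E : L0 = (L :&: lker (coord_lfun R i0))%VS.
  apply/vspaceP => f; rewrite memv_cap memv_ker lfunE /=; apply/memv_imgP/andP.
    move=> [c _ ->]; rewrite rmul_lfunE; split.
      apply/affine_valuesP; exists (- c), (- dotp c (p i0)) => i.
      by rewrite mul_trmx_dotp -[- c]scaleN1r dotpZl dotpDr -scaleN1r dotpZr; ring.
    apply/eqP/matrixP => x y; rewrite mxE ord1 mul_trmx_dotp subrr.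
    by rewrite dotpE trmx0 mulmx0 !mxE.
  move=> [/affine_valuesP[c [b fE]] /eqP/matrixP/(_ 0 0)]; rewrite !mxE fE => E.
  exists (- c); rewrite ?memvf //; apply/rowP => i; rewrite rmul_lfunE mul_trmx_dotp fE.
  by rewrite -[- c]scaleN1r dotpZl dotpDr -scaleN1r dotpZr; move: E; lra.
have dL : \dim L = (\dim L0).+1.
  rewrite L0E -(limg_ker_dim (coord_lfun R i0) L).
  suff -> : \dim (coord_lfun R i0 @: L) = 1%N by rewrite addn1.
  apply/eqP; rewrite eqn_leq; apply/andP; split.
    by apply: leq_trans (dimvS (subvf _)) _; rewrite dimvf.
  rewrite lt0n dimv_eq0; apply/negP => /eqP E.
  have := memv_img (coord_lfun R i0) oneL; rewrite E memv0 lfunE /= => /eqP/matrixP/(_ 0 0).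
  by rewrite !mxE => /eqP; rewrite oner_eq0.
pose mask : 'M[R]_N := diag_mx (\row_i (i \in I)%:R).
pose mk := rmul_lfun mask.
have mkE f i : (mk f) 0 i = f 0 i * (i \in I)%:R by rewrite rmul_lfunE mul_mx_diag !mxE.
rewrite dL addnS; congr _.+1; rewrite -(limg_ker_dim mk L0); congr (\dim _ + _)%N.
  apply/vspaceP => f; rewrite L0E 2!memv_cap !memv_ker; apply/idP/annP.
    move=> /andP[/andP[fL _] /eqP/rowP f0]; split=> // i iI.
    by have := f0 i; rewrite mkE iI mulr1 mxE.
  move=> [fL f0]; rewrite fL /=; apply/andP; split.
    by apply/eqP/matrixP => x y; rewrite lfunE /= !mxE ord1 f0.
  by apply/eqP/rowP => i; rewrite mkE mxE; case: (boolP (i \in I)) => [/f0 ->|_]; rewrite ?mul0r ?mulr0.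
have -> : (mk @: L0)%VS = limg (rmul_lfun (D^T *m mask)).
  rewrite /L0 -limg_comp; apply: eq_in_limg => c _.
  by rewrite comp_lfunE !rmul_lfunE mulmxA.
rewrite !dim_limg_mulmxr -mxrank_tr trmx_mul trmxK tr_diag_mx; congr (\rank _).
apply/matrixP => i j; rewrite mul_diag_mx !mxE.
by case: (i \in I); rewrite !mxE ?mul1r ?mul0r.
Qed.
End AffineFunctionals.

Lemma sum1_neq0 (R : nzRingType) (I : finType) (a : I -> R) :
  \sum_i a i = 1 -> exists i, a i != 0.
Proof.
move=> a1; apply/existsP; rewrite -negb_forall; apply/negP => /forallP h.
by move/eqP: a1; rewrite big1 => [|i _]; [rewrite eq_sym oner_eq0 | apply/eqP].
Qed.

(** * Affine hulls and dimension *)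

Section AffineHull.
Variables (R : realType) (n : nat).
Local Notation V := 'rV[R]_n.

Lemma has_dim_inj (A : set V) i j : has_dim A i -> has_dim A j -> i = j.
Proof.
move=> [x [U [xE <-]]] [y [W [yE <-]]]; congr (\dim _).
suff sub (x' y' : V) (U' W' : {vspace V}) :
    [set x' + u | u in [set` U']] = [set y' + u | u in [set` W']] -> (U' <= W')%VS.
  by apply/eqP; rewrite eqEsubv (sub x y) ?(sub y x) // -xE -yE.
move=> E; apply/subvP => u uU.
have [w0 w0W x'E] : [set y' + w | w in [set` W']] x' by rewrite -E; exists 0; rewrite /= ?mem0v ?addr0.
have [w wW wE] : [set y' + w | w in [set` W']] (x' + u) by rewrite -E; exists u.
have -> : u = w - w0 by apply: (addrI x'); rewrite -wE -x'E; apply/rowP => l; rewrite !mxE; ring.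
exact: memvB.
Qed.

Lemma affine_translate (x : V) (U : {vspace V}) : affine_set [set x + u | u in [set` U]].
Proof.
move=> _ _ t [u uU <-] [w wU <-]; exists (t *: u + (1 - t) *: w).
  by rewrite /= memvD ?memvZ.
by apply/rowP => l; rewrite !mxE; ring.
Qed.

Lemma affine_hull_spanned N (p : 'I_N -> V) i0 (I : {set 'I_N}) (F : set V) : i0 \in I ->
  (forall i, i \in I -> F (p i)) -> F `<=` [set p i0 + u | u in [set` directions p i0 I]] ->
  affine_hull F = [set p i0 + u | u in [set` directions p i0 I]].
Proof.
move=> i0I pF Fp; apply/seteqP; split; first by apply: smallest_sub => //; exact: affine_translate.
move=> _ [u /memv_imgP[a _ ->] <-] C [affC FC].
have Cp i : i \in I -> C (p i) by move=> /pF /FC.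
(* [C] translated by [- p i0] is a linear subspace: scalings are affine combinations with [p i0],
   and [v + w] is the midpoint of [2 v] and [2 w]. *)
pose W (v : V) := C (p i0 + v).
have W0 : W 0 by rewrite /W addr0; exact: Cp.
have WZ t v : W v -> W (t *: v).
  move=> Wv; have := affC _ _ t Wv (Cp _ i0I); congr (C _).
  by apply/rowP => l; rewrite !mxE; ring.
have WD v w : W v -> W w -> W (v + w).
  move=> Wv Ww; have := affC _ _ 2^-1 (WZ 2 _ Wv) (WZ 2 _ Ww); congr (C _).
  by apply/rowP => l; rewrite !mxE; field.
rewrite -/(W _) rmul_lfunE mulmx_sum_row; apply: big_ind => // i _.
apply: WZ; rewrite rowK; case: ifP => // iI; rewrite /W addrC subrK; exact: Cp.
Qed.

Lemma has_dim_spanned N (p : 'I_N -> V) i0 (I : {set 'I_N}) (F : set V) r : i0 \in I ->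
  (forall i, i \in I -> F (p i)) -> F `<=` [set p i0 + u | u in [set` directions p i0 I]] ->
  has_dim F r <-> \dim (affine_values p) = (\dim (ann (affine_values p) I) + r.+1)%N.
Proof.
move=> i0I pF Fp; have h : has_dim F (\dim (directions p i0 I)).
  by exists (p i0), (directions p i0 I); split=> //; exact: affine_hull_spanned.
rewrite (dim_ann_directions p i0I); split=> [/(has_dim_inj h) ->//|/eqP].
by rewrite eqn_add2l => /eqP[<-].
Qed.

Lemma has_dim_nonempty (F : set V) r : has_dim F r -> F !=set0.
Proof.
move=> [x [U [E _]]]; apply/set0P/negP => /eqP F0.
have : affine_hull F x by rewrite E; exists 0; rewrite /= ?mem0v ?addr0.
by move=> /(_ set0); apply; split; rewrite ?F0.
Qed.

Lemma has_dim0 (F : set V) : has_dim F 0 <-> exists x, F = [set x].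
Proof.
split=> [h|[x ->]].
  have [y Fy] := has_dim_nonempty h; exists y.
  case: h => x [U [E /eqP]]; rewrite dimv_eq0 => /eqP U0.
  have Fx z : F z -> z = x.
    move=> Fz; have : affine_hull F z by move=> C [_]; apply.
    by rewrite E U0 => -[u /=]; rewrite memv0 => /eqP -> <-; rewrite addr0.
  by apply/seteqP; split=> z /=; [move=> /Fx ->; rewrite (Fx _ Fy)|move=> ->].
exists x, 0%VS; split; last exact: dimv0.
have -> : [set x + u | u in [set` (0%VS : {vspace V})]] = [set x].
  apply/seteqP; split=> z /=; first by move=> [u]; rewrite memv0 => /eqP -> <-; rewrite addr0.
  by move=> ->; exists 0; rewrite ?mem0v ?addr0.
apply/seteqP; split; last by move=> _ -> C [_]; apply.
by apply: smallest_sub => // u w t -> ->; rewrite /= -scalerDl addrC subrK scale1r.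
Qed.
End AffineHull.

(** * From polytopes to configurations of their vertices *)

Section Main.
Variables (R : realType) (n N : nat) (p : 'I_N -> 'rV[R]_n).
Local Notation V := 'rV[R]_n.
Local Notation P := (convex_comb p).
Local Notation L := (affine_values p).
Hypotheses (pinj : injective p) (pexp : forall i, face P [set p i]).

Definition contact c (b : R) : {set 'I_N} := finset (fun i => dotp c (p i) == b).

Lemma face_spanned c b i0 : (forall i, dotp c (p i) <= b) -> i0 \in contact c b ->
  P `&` [set x | dotp c x = b] `<=`
    [set p i0 + u | u in [set` directions p i0 (contact c b)]].
Proof.
move=> cb i0b x [[a [a0 a1 ->]] /= E]; have sup := convex_comb_support a0 a1 cb E.
exists (\sum_i a i *: p i - p i0); last by rewrite addrC subrK.
have -> : \sum_i a i *: p i - p i0 = rmul_lfun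
    (\matrix_i (if i \in contact c b then p i - p i0 else 0)) (\row_i a i).
  rewrite rmul_lfunE mulmx_sum_row -[X in _ - X]scale1r -a1 scaler_suml -sumrB.
  apply: eq_bigr => i _; rewrite rowK mxE -scalerBr inE.
  by have [->|/sup ->] := eqVneq (a i) 0; rewrite ?scale0r // eqxx.
by rewrite /= memv_img ?memvf.
Qed.

(** Any [p i] of nonzero weight in a vertex [x] lies on the face [[set x]]. *)
Lemma vertices_exposed : vertices P = range p.
Proof.
apply/seteqP; split=> [x [c [b [cb xE]]]|_ [i _ <-]]; last exact: pexp.
have : [set x] x by [].
rewrite xE => -[[a [a0 a1 xa]] /= E]; rewrite xa in E.
have cb' i : dotp c (p i) <= b by apply: cb; exact: convex_comb_gen.
have [i ai] := sum1_neq0 a1.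
exists i => //; have : (P `&` [set x | dotp c x = b]) (p i).
  by split; [exact: convex_comb_gen|exact: convex_comb_support a0 a1 cb' E _ ai].
by rewrite -xE.
Qed.

(** A face is the hull of its contact set, and there are finitely many of these. *)
Lemma faces_finite r : finite_set (faces_of_dim r P).
Proof.
pose hull (I : {set 'I_N}) : set V := [set x | exists a : 'I_N -> R,
  [/\ forall i, 0 <= a i, \sum_i a i = 1, x = \sum_i a i *: p i &
      forall i, a i != 0 -> i \in I]].
apply: (@sub_finite_set _ _ (range hull)); last first.
  by apply: finite_image; exact: finite_finset.
move=> F [[c [b [cb ->]]] _]; exists (contact c b) => //.
have cb' i : dotp c (p i) <= b by apply: cb; exact: convex_comb_gen.
apply/seteqP; split=> x.
  move=> [a [a0 a1 -> aI]]; split; first by exists a.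
  rewrite /= dotp_sumr -[b]mul1r -a1 mulr_suml; apply: eq_bigr => i _.
  rewrite dotpZr; have [->|/aI] := eqVneq (a i) 0; first by rewrite !mul0r.
  by rewrite inE => /eqP ->.
move=> [[a [a0 a1 ->]] /= E]; exists a; split=> // i ai.
by rewrite inE (convex_comb_support a0 a1 cb' E ai).
Qed.

Lemma fnum0 : fnum 0 P = N.
Proof.
rewrite -[RHS]card_ord -(@card_fset_set_range _ _ (fun i => [set p i])); last first.
  by move=> i j E; apply: pinj; have : [set p i] (p i) by []; rewrite E.
rewrite /fnum; congr (#|` fset_set _|%fset); apply/seteqP; split.
  move=> F [Pf /has_dim0[x xE]]; move: Pf; rewrite xE => Px.
  have : vertices P x by [].
  by rewrite vertices_exposed => -[i _ <-]; exists i.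
by move=> _ [i _ <-]; split; [exact: pexp|apply/has_dim0; exists (p i)].
Qed.

(** The slack vector of the face [F] with vertex set [S] works: each [p i] on [F] is a vertex of
    [F], since the inequality exposing it in [P] also exposes it in [F]. *)
Lemma neighborly_exposed k : neighborly k P -> neighborly_on L k [set: 'I_N]%SET.
Proof.
move=> nP S _ Sk; have [||F [c [b [cb FE]]] vF] := nP (p @` [set` S]).
- by rewrite vertices_exposed => _ [i _ <-]; exists i.
- have -> : p @` [set` S] = [set` [fset x in [seq p i | i <- enum S]]%fset].
    apply/seteqP; split=> x /=; rewrite inE /=.
      by move=> [i iS <-]; rewrite map_f // mem_enum.
    by move=> /mapP[i]; rewrite mem_enum => iS ->; exists i.
  by apply/card_eq_fsetP; rewrite card_fseq undup_id ?map_inj_uniq ?enum_uniq // size_map -cardE.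
have cb' i : dotp c (p i) <= b by apply: cb; exact: convex_comb_gen.
exists (\row_i (b - dotp c (p i))).
  by apply/affine_valuesP; exists c, b => i; rewrite mxE.
split=> [i _|]; first by rewrite mxE subr_ge0.
apply/setP => i; rewrite !inE mxE subr_eq0 eq_sym.
have iF : vertices F (p i) <-> i \in S.
  by rewrite vF; split=> [[j jS /pinj <-]//|iS]; exists i.
apply/eqP/idP => [E|/iF].
  apply/iF.
  have [c' [b' [cb'' iE]]] := pexp i; exists c', b'; split.
    by move=> x; rewrite FE => -[/cb''].
  apply/seteqP; split=> x.
    move=> ->; have : [set p i] (p i) by []. 
    by rewrite iE => -[_ /= ?]; split=> //; rewrite FE; split=> //; exact: convex_comb_gen.
  by rewrite FE iE => -[[]].
move=> [c' [b' [_ iE]]]; have : [set p i] (p i) by [].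
by rewrite iE FE => -[[]].
Qed.

Lemma ann_setT : ann L [set: 'I_N]%SET = 0%VS.
Proof.
apply/eqP; rewrite -subv0; apply/subvP => f /annP[_ f0].
by rewrite memv0; apply/eqP/rowP => i; rewrite mxE f0 ?inE.
Qed.

Lemma dim_affine_values d : has_dim P d -> \dim L = d.+1.
Proof.
move=> hd; have [x [a [a0 a1 _]]] := has_dim_nonempty hd.
have [i0 _] := sum1_neq0 a1.
(* The zero functional presents [P] as a face of itself, touching every point. *)
have cT : contact 0 0 = [set: 'I_N]%SET.
  by apply/setP => i; rewrite !inE dotpE mul0mx mxE eqxx.
have dot0 (y : V) : dotp 0 y = 0 :> R by rewrite dotpE mul0mx mxE.
have := @has_dim_spanned _ _ _ p i0 [set: 'I_N]%SET P d (finset.in_setT i0); rewrite ann_setT dimv0 add0n; case.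
- by move=> i _; exact: convex_comb_gen.
- rewrite -cT; apply: subset_trans (face_spanned _ _) => //.
  + by move=> y Py; split=> //; exact: dot0.
  + by move=> i; rewrite dot0.
  + by rewrite inE dot0.
by move=> /(_ hd).
Qed.

(** The functional of [J] cuts out a face of [P], from which [J] is recovered as the set of indices
    of points on it. *)
Lemma leq_facets_fnum d : (0 < d)%N -> has_dim P d ->
  (#|facets L [set: 'I_N]%SET| <= fnum (d - 1) P)%N.
Proof.
move=> d0 hd; have dL := dim_affine_values hd.
have /choice[g gP] : forall J : {set 'I_N}, exists F : set V,
    J \in facets L [set: 'I_N]%SET ->
    faces_of_dim (d - 1) P F /\ forall i, F (p i) <-> i \in J.
  move=> J; have [JF|_] := boolP (J \in _); last by exists set0.
  have [f /affine_valuesP[c [b fE]] [f0 fJ _]] := facetsP JF.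
  have cb i : dotp c (p i) <= b by have := f0 i (finset.in_setT i); rewrite fE subr_ge0.
  have JE : J = contact c b.
    by apply/setP => i; rewrite -fJ !inE fE subr_eq0 eq_sym.
  exists (P `&` [set x | dotp c x = b]) => _; split; last first.
    move=> i; rewrite JE inE; split=> [[_ /= ->]//|/eqP E].
    by split=> //; exact: convex_comb_gen.
  split; first by exists c, b; split=> // x /convex_comb_le; apply.
  have dJ := facet_dim JF; rewrite ann_setT dimv0 in dJ.
  (* [J] has rank [d > 0], so it is nonempty and offers a base point. *)
  have [i0 i0J] : exists i, i \in J.
    apply/set0Pn/negP => /eqP J0; have := dim_leq_ann_card L J.
    by rewrite J0 cards0 -J0 dJ dL; move: d0; case: (d).
  apply/(has_dim_spanned (p := p) (I := J) (i0 := i0)) => //.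
  - by move=> i; rewrite JE inE => /eqP E; split=> //; exact: convex_comb_gen.
  - by rewrite JE; apply: face_spanned => //; rewrite -JE.
  - by rewrite dJ dL subn1 prednK.
apply: (@leq_card_fset_set _ _ g); first exact: faces_finite.
  move=> J H JF HF E; apply/setP => i; apply/idP/idP.
    by move=> /(gP J JF).2; rewrite E => /(gP H HF).2.
  by move=> /(gP H HF).2; rewrite -E => /(gP J JF).2.
by move=> J /gP[].
Qed.

(** When [L] is the full space, the indicator of [j] is the value vector of an affine functional;
    applying that functional to an affine relation isolates [a j]. *)
Lemma affinely_independent_full : \dim L = N -> affinely_independent p.
Proof.
move=> dN a a0 ap j.
have Lf : L = fullv by apply/eqP; rewrite eqEdim subvf dimvf /dim /= mul1n dN leqnn.
have /affine_valuesP[c [b fE]] : delta_mx 0 j \in L by rewrite Lf memvf.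
have : \sum_i a i * (b - dotp c (p i)) = 0.
  under eq_bigr do rewrite mulrBr -dotpZr.
  rewrite sumrB -mulr_suml a0 mul0r -dotp_sumr ap -(scale0r 0) dotpZr mul0r subrr //.
rewrite (bigD1 j) //= -fE mxE !eqxx mulr1 big1 ?addr0 // => i ij.
by rewrite -fE mxE (negPf ij) andbF mulr0.
Qed.
End Main.

Theorem theorem2 (R : realType) (n d k : nat) (P : set 'rV[R]_n)
    (hP : dpolytope d P) (hk : neighborly k P)
    (hkd : (2 * k < d)%N) (hdk : (d <= 3 * k - 1)%N) :
  (fnum 0 P <= fnum (d - 1) P)%N /\
  (fnum (d - 1) P = fnum 0 P -> simplex P).
Proof.
case: hP => /polytope_vertices[N [p [pinj PE pexp]]] hd; subst P.
have dL := dim_affine_values hd.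
have dA : \dim (affine_values p) =
    (\dim (ann (affine_values p) [set: 'I_N]%SET) + d.+1)%N by rewrite ann_setT dimv0.
have [le eq] := card_facets_neighborly hkd hdk (neighborly_exposed pinj pexp hk) dA.
have lef := leq_facets_fnum (leq_ltn_trans (leq0n _) hkd) hd.
rewrite cardsT card_ord in le eq.
rewrite (fnum0 pinj pexp); split=> [|E]; first exact: leq_trans lef.
(* The facets of the configuration are squeezed between [N] and [fnum (d - 1) P = N]. *)
have {eq} Nd : N = d.+1 by apply: eq; apply/eqP; rewrite eqn_leq le -[X in (_ <= X)%N]E lef.
have pind := affinely_independent_full (etrans dL (esym Nd)).
by move: p {pinj pexp hd dL dA le lef E hk} pind; rewrite Nd => p pind; exists d, p; rewrite convex_hullE.
Qed.
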